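(* Let $0<s\le1$ and let $f(z)=z+\sum_{n=2}^{\infty}a_nz^n$ belong to the class $\mathcal{ST}_{hpl}(s)$. Then the second Hankel determinant $H_2(2)=a_2a_4-a_3^2$ of $f$ satisfies $$|H_2(2)|=|a_2a_4-a_3^2|\le\frac{s^2}{4}.$$ The inequality is sharp: equality holds if $f$ is a rotation of $\Phi_{s,2}$, that is, $f(z)=\overline{\mu}\,\Phi_{s,2}(\mu z)$ with $|\mu|=1$.
   Context: Let $\mathbb{D}=\{z\in\mathbb{C}:|z|<1\}$, and let $\mathcal{S}$ be the class of functions $f(z)=z+\sum_{n\ge2}a_nz^n$ that are holomorphic and univalent in $\mathbb{D}$. For $0<s\le1$ put $\mathfrak{q}_s(z)=(1-z)^{-s}=e^{-s\ln(1-z)}$, $z\in\mathbb{D}$, with the branch of the logarithm such that $\mathfrak{q}_s(0)=1$. For holomorphic functions $p,F$ in $\mathbb{D}$, $p\prec F$ (subordination) means that there is a holomorphic $\omega:\mathbb{D}\to\mathbb{D}$ with $\omega(0)=0$ and $p(z)=F(\omega(z))$ for all $z\in\mathbb{D}$. The class $\mathcal{ST}_{hpl}(s)$ consists of all $f\in\mathcal{S}$ with $\frac{zf'(z)}{f(z)}\prec\mathfrak{q}_s(z)$ in $\mathbb{D}$. The function $\Phi_{s,2}\in\mathcal{ST}_{hpl}(s)$ is defined by $\frac{z\Phi_{s,2}'(z)}{\Phi_{s,2}(z)}=\frac{1}{(1-z^2)^s}$, i.e. $\Phi_{s,2}(z)=z\exp\left(\int_0^z\frac{\mathfrak{q}_s(t^2)-1}{t}\,dt\right)$.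 *)

(* Defs.v *)
From Stdlib Require Import Reals.
From Coquelicot Require Import Coquelicot.

Definition in_disk (z : C) : Prop := (Cmod z < 1)%R.

Definition holomorphic_in_disk (f : C -> C) : Prop :=
  forall z : C, in_disk z -> ex_derive f z.

Definition univalent_in_disk (f : C -> C) : Prop :=
  forall z w : C, in_disk z -> in_disk w -> f z = f w -> z = w.

(* f(z) = z + a_2 z^2 + a_3 z^3 + ... throughout the unit disk. *)
Definition normalized_expansion (f : C -> C) (a : nat -> C) : Prop :=
  a 0%nat = RtoC 0 /\ a 1%nat = RtoC 1 /\
  forall z : C, in_disk z -> is_pseries a z (f z).

Definition class_S (f : C -> C) : Prop :=
  holomorphic_in_disk f /\ univalent_in_disk f /\
  exists a : nat -> C, normalized_expansion f a.

Definition Cexp (z : C) : C :=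
  (exp (Re z) * cos (Im z), exp (Re z) * sin (Im z))%R.

(* The principal logarithm, meant for 0 < Re w only: there the principal
   argument is atan (Im w / Re w).  It is only applied to w = 1 - z with
   |z| < 1. *)
Definition Clog_right (w : C) : C := (ln (Cmod w), atan (Im w / Re w))%R.

Definition q_hpl (s : R) (z : C) : C :=
  Cexp (- (RtoC s * Clog_right (1 - z)))%C.

Definition schwarz_function (w : C -> C) : Prop :=
  holomorphic_in_disk w /\ (forall z : C, in_disk z -> in_disk (w z)) /\
  w (RtoC 0) = RtoC 0.

Definition subordinate (p F : C -> C) : Prop :=
  exists w : C -> C, schwarz_function w /\
    forall z : C, in_disk z -> p z = F (w z).

(* z f'(z) / f(z), with the removable singularity at 0 filled in: for f in
   class_S the value there is 1. *)
Definition starlike_quotient (f : C -> C) (z : C) : C :=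
  if Ceq_dec z (RtoC 0) then RtoC 1 else (z * C_derive f z / f z)%C.

Definition ST_hpl (s : R) (f : C -> C) : Prop :=
  class_S f /\ subordinate (starlike_quotient f) (q_hpl s).

(* Phi_{s,2}(z) = z exp (int_0^z (q_s(t^2) - 1) / t dt), the integral being
   taken along the segment t = x z, 0 <= x <= 1.  The value of the integrand
   at x = 0, where t = 0, does not affect the Riemann integral. *)
Definition Phi2 (s : R) (z : C) : C :=
  (z * Cexp (RInt (V := C_R_CompleteNormedModule)
    (fun x : R =>
       let t := (RtoC x * z)%C in ((q_hpl s (t ^ 2) - 1) / t * z)%C)
    0 1))%C.

Definition rotation (mu : C) (f : C -> C) (z : C) : C :=
  (Cconj mu * f (mu * z))%C.

(* Main.v *)
Require Import Defs.
From Stdlib Require Import Reals Lra Lia Psatz Wf_nat.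
From Coquelicot Require Import Coquelicot.
Local Open Scope R_scope.

(** Let w be the Schwarz function with z f' / f = q_s(w), and c1, c2, c3 its first
    Taylor coefficients. Comparing coefficients gives a2, a3, a4 in terms of the
    c's, and

      (a2 a4 - a3^2) / s^2 = c1 c3 / 3 - c2^2 / 4 + (s + 1) / 12 c1^2 c2 + K c1^4,
      K = (1 - s)(13 s + 7) / 144,  0 <= K <= 1 / 18

    (hankel_in_schwarz). Since |w| < 1, multiplication by w does not increase the
    mean square on circles; truncating Taylor series keeps this true, so the lower
    triangular Toeplitz matrix of c1, c2, c3 is a contraction (schwarz_toeplitz).
    Eliminating unknowns from this family of inequalities yields Schur's bounds:
    with d = 1 - |c1|^2,

      |c2| <= d,  c3 = rest - conj(c1) c2^2 / d,  |rest| d <= d^2 - |c2|^2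

    (schur_bounds). Inserting them leaves a real inequality in |c1| and |c2| / d,
    with maximum 1 / 4 attained at c1 = 0, |c2| = 1 (hankel_schwarz_bound).

    The contraction rests on one analytic fact, Re_center_nonneg: a function that
    is continuously differentiable in the punctured disk, continuous at 0 and of
    nonnegative real part on a circle has nonnegative real part at 0. The required
    regularity of w is read off from f: differentiating z f' = q_s(w) f gives a
    linear differential equation for 1 - w with power series coefficients
    (schwarz_ode), and the same equation identifies the Taylor coefficients of w by
    bootstrapping the order of the remainder (schwarz_taylor).

    For the extremal function, Phi(z) = z exp(J(z)) with J' = Q and
    z Q(z) = q_s(z^2) - 1. The coefficients of Q lie in [0, 1], hence those of
    exp(J) do not exceed 1 in modulus and the series converges in the disk
    (CPS_exp). Univalence is seen in the coordinate log z, where log Phi has a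
    derivative of positive real part on a half-plane (Phi2_log_injective). The
    Schwarz function of the rotation by mu is mu^2 z^2, so that c1 = c3 = 0 and
    |c2| = 1, and the bound is attained (hankel_extremal). *)

(** * Continuity and differentiability of complex functions *)

(** Complex differentiability, with the normed module structure pinned down:
    C also carries a real one. *)
Definition cder (f : C -> C) (z l : C) : Prop :=
  @is_derive C_AbsRing C_NormedModule f z l.

Lemma cder_iff_eps (f : C -> C) (z l : C) :
  cder f z l <->
  forall e, 0 < e -> exists d, 0 < d /\ forall w, Cmod (w - z) < d ->
    Cmod (f w - f z - l * (w - z)) <= e * Cmod (w - z).
Proof.
  unfold cder. split.
  - intros [_ H] e he.
    destruct (H z (fun P HP => HP) (mkposreal e he)) as [d Hd].
    exists d; split; [apply cond_pos|]. intros w Hw.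
    specialize (Hd w Hw). simpl in Hd.
    rewrite (Cmult_comm l). exact Hd.
  - intros H. split.
    + apply (is_linear_scal_l (K:=C_AbsRing)).
    + intros x Hx e.
      assert (z = x) by (apply (@is_filter_lim_locally_unique C_AbsRing (AbsRing_NormedModule C_AbsRing)); exact Hx). subst x.
      destruct (H e (cond_pos e)) as [d [d0 Hd]].
      exists (mkposreal d d0). intros w Hw. specialize (Hd w Hw).
      rewrite (Cmult_comm l) in Hd. exact Hd.
Qed.

(** Continuity stated with the modulus, so that the two uniform structures
    carried by C need not be told apart. *)
Definition ccont (f : C -> C) (z : C) : Prop :=
  forall e, 0 < e -> exists d, 0 < d /\ forall w, Cmod (w - z) < d -> Cmod (f w - f z) < e.

Lemma ccont_const (c z : C) : ccont (fun _ => c) z.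
Proof.
  intros e he; exists 1; split; [lra|]; intros w _.
  replace (c - c)%C with (RtoC 0) by ring. rewrite Cmod_0; lra.
Qed.

Lemma ccont_id (z : C) : ccont (fun w => w) z.
Proof. intros e he; exists e; split; auto. Qed.

Lemma ccont_ext_loc (f g : C -> C) (z : C) (r : R) : 0 < r ->
  (forall w, Cmod (w - z) < r -> f w = g w) -> ccont f z -> ccont g z.
Proof.
  intros hr E H e he. destruct (H e he) as [d [d0 Hd]].
  exists (Rmin d r); split; [apply Rmin_pos; assumption|].
  intros w Hw.
  rewrite <- !E.
  - apply Hd. eapply Rlt_le_trans; [exact Hw|apply Rmin_l].
  - replace (z - z)%C with (RtoC 0) by ring. rewrite Cmod_0; lra.
  - eapply Rlt_le_trans; [exact Hw|apply Rmin_r].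
Qed.

Lemma ccont_plus (f g : C -> C) (z : C) :
  ccont f z -> ccont g z -> ccont (fun w => f w + g w)%C z.
Proof.
  intros Hf Hg e he.
  destruct (Hf (e/2) ltac:(lra)) as [d1 [d1p H1]], (Hg (e/2) ltac:(lra)) as [d2 [d2p H2]].
  exists (Rmin d1 d2); split; [apply Rmin_pos; assumption|]. intros w Hw.
  replace (f w + g w - (f z + g z))%C with ((f w - f z) + (g w - g z))%C by ring.
  eapply Rle_lt_trans; [apply Cmod_triangle|].
  specialize (H1 w (Rlt_le_trans _ _ _ Hw (Rmin_l _ _))).
  specialize (H2 w (Rlt_le_trans _ _ _ Hw (Rmin_r _ _))). lra.
Qed.

Lemma ccont_bounded (f : C -> C) (z : C) : ccont f z ->
  exists d, 0 < d /\ forall w, Cmod (w - z) < d -> Cmod (f w) <= Cmod (f z) + 1.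
Proof.
  intros H. destruct (H 1 ltac:(lra)) as [d [d0 Hd]]. exists d; split; auto.
  intros w Hw. specialize (Hd w Hw).
  replace (f w) with ((f w - f z) + f z)%C by ring.
  eapply Rle_trans; [apply Cmod_triangle|]. lra.
Qed.

Lemma ccont_mult (f g : C -> C) (z : C) :
  ccont f z -> ccont g z -> ccont (fun w => f w * g w)%C z.
Proof.
  intros Hf Hg e he.
  destruct (ccont_bounded f z Hf) as [d0 [d0p H0]].
  set (A := Cmod (f z) + 1) in *. set (B := Cmod (g z) + 1).
  assert (hA : 0 < A) by (pose proof (Cmod_ge_0 (f z)); unfold A; lra).
  assert (hB : 0 < B) by (pose proof (Cmod_ge_0 (g z)); unfold B; lra).
  destruct (Hf (e/2/B)) as [d1 [d1p H1]]; [repeat apply Rdiv_lt_0_compat; lra|].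
  destruct (Hg (e/2/A)) as [d2 [d2p H2]]; [repeat apply Rdiv_lt_0_compat; lra|].
  exists (Rmin d0 (Rmin d1 d2)); split; [repeat apply Rmin_pos; assumption|]. intros w Hw.
  assert (w0 : Cmod (w - z) < d0) by (eapply Rlt_le_trans; [exact Hw|apply Rmin_l]).
  assert (w1 : Cmod (w - z) < d1)
    by (eapply Rlt_le_trans; [exact Hw|eapply Rle_trans; [apply Rmin_r|apply Rmin_l]]).
  assert (w2 : Cmod (w - z) < d2)
    by (eapply Rlt_le_trans; [exact Hw|eapply Rle_trans; [apply Rmin_r|apply Rmin_r]]).
  specialize (H0 w w0). specialize (H1 w w1). specialize (H2 w w2).
  replace (f w * g w - f z * g z)%C with (f w * (g w - g z) + (f w - f z) * g z)%C by ring.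
  eapply Rle_lt_trans; [apply Cmod_triangle|]. rewrite !Cmod_mult.
  assert (Cmod (f w) * Cmod (g w - g z) <= A * Cmod (g w - g z)).
  { apply Rmult_le_compat_r; [apply Cmod_ge_0|exact H0]. }
  assert (A * Cmod (g w - g z) < A * (e/2/A)) by (apply Rmult_lt_compat_l; assumption).
  assert (Cmod (f w - f z) * Cmod (g z) <= e/2/B * B).
  { apply Rmult_le_compat; try apply Cmod_ge_0; [lra|unfold B; lra]. }
  replace (A * (e/2/A)) with (e/2) in * by (field; lra).
  replace (e/2/B*B) with (e/2) in * by (field; lra). lra.
Qed.

Lemma ccont_comp (f g : C -> C) (z : C) :
  ccont g z -> ccont f (g z) -> ccont (fun w => f (g w)) z.
Proof.
  intros Hg Hf e he. destruct (Hf e he) as [d [d0 Hd]].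
  destruct (Hg d d0) as [d' [d0' Hd']]. exists d'; split; auto.
Qed.

Lemma Cmod_lower (x y : C) : Cmod y - Cmod (x - y) <= Cmod x.
Proof.
  pose proof (Cmod_triangle x (-(x - y))) as H. rewrite Cmod_opp in H.
  replace (x + - (x - y))%C with y in H by ring. lra.
Qed.

Lemma Cmod_minus_sym (x y : C) : Cmod (x - y) = Cmod (y - x).
Proof. rewrite <- Cmod_opp. f_equal. ring. Qed.

Lemma ccont_away (f : C -> C) (z : C) : ccont f z -> f z <> RtoC 0 ->
  exists d, 0 < d /\ forall w, Cmod (w - z) < d -> Cmod (f z) / 2 < Cmod (f w).
Proof.
  intros H n. assert (0 < Cmod (f z)) by (apply Cmod_gt_0; exact n).
  destruct (H (Cmod (f z) / 2) ltac:(lra)) as [d [d0 Hd]].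
  exists d; split; auto. intros w Hw. specialize (Hd w Hw).
  pose proof (Cmod_lower (f w) (f z)). lra.
Qed.

Lemma ccont_inv (f : C -> C) (z : C) : ccont f z -> f z <> RtoC 0 ->
  ccont (fun w => / f w)%C z.
Proof.
  intros H n e he. assert (p : 0 < Cmod (f z)) by (apply Cmod_gt_0; exact n).
  destruct (ccont_away f z H n) as [d1 [d1p H1]].
  set (m := Cmod (f z)) in *.
  destruct (H (e * (m * m / 2))) as [d2 [d2p H2]].
  { apply Rmult_lt_0_compat; [lra|]. apply Rdiv_lt_0_compat; [nra|lra]. }
  exists (Rmin d1 d2); split; [apply Rmin_pos; assumption|]. intros w Hw.
  specialize (H1 w (Rlt_le_trans _ _ _ Hw (Rmin_l _ _))).
  specialize (H2 w (Rlt_le_trans _ _ _ Hw (Rmin_r _ _))).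
  assert (nw : f w <> RtoC 0).
  { intros E. rewrite E, Cmod_0 in H1. lra. }
  replace (/ f w - / f z)%C with ((f z - f w) * / (f w * f z))%C by (field; auto).
  rewrite Cmod_mult, Cmod_inv by (apply Cmult_neq_0; assumption).
  rewrite Cmod_mult, Cmod_minus_sym. fold m.
  assert (m * m / 2 < Cmod (f w) * m) by nra.
  assert (0 < m * m / 2) by nra.
  apply Rmult_lt_reg_r with (Cmod (f w) * m); [lra|].
  rewrite Rmult_assoc, Rinv_l, Rmult_1_r by lra.
  eapply Rlt_le_trans; [exact H2|]. apply Rmult_le_compat_l; lra.
Qed.

(** Caratheodory's form of the derivative: a slope function continuous at the
    base point.  It turns the product, chain and quotient rules into statements
    about continuity. *)
Lemma cder_iff_slope (f : C -> C) (z l : C) :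
  cder f z l <->
  exists g, ccont g z /\ g z = l /\
    exists d, 0 < d /\ forall w, Cmod (w - z) < d -> f w = (f z + g w * (w - z))%C.
Proof.
  rewrite cder_iff_eps. split.
  - intros H.
    exists (fun w => if Ceq_dec w z then l else ((f w - f z) / (w - z))%C).
    repeat split.
    + intros e he. destruct (H (e/2) ltac:(lra)) as [d [d0 Hd]].
      exists d; split; auto. intros w Hw. specialize (Hd w Hw).
      destruct (Ceq_dec z z) as [_|c]; [|congruence].
      destruct (Ceq_dec w z) as [->|n].
      { replace (l - l)%C with (RtoC 0) by ring. rewrite Cmod_0; lra. }
      assert (n' : (w - z)%C <> RtoC 0).
      { intros E. apply n. replace w with ((w - z) + z)%C by ring. rewrite E. ring. }
      assert (p : 0 < Cmod (w - z)) by (apply Cmod_gt_0; exact n').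
      replace ((f w - f z) / (w - z) - l)%C
        with ((f w - f z - l * (w - z)) / (w - z))%C by (field; auto).
      rewrite Cmod_div by assumption.
      apply Rle_lt_trans with (e/2); [|lra].
      apply Rmult_le_reg_r with (Cmod (w - z)); [lra|].
      unfold Rdiv at 1. rewrite Rmult_assoc, Rinv_l by lra. lra.
    + destruct (Ceq_dec z z) as [_|c]; [reflexivity|congruence].
    + exists 1; split; [lra|]. intros w _.
      destruct (Ceq_dec w z) as [->|n]; [ring|].
      field. intros E. apply n. replace w with ((w - z) + z)%C by ring. rewrite E. ring.
  - intros [g [Hg [<- [d0 [d0p E]]]]] e he.
    destruct (Hg e he) as [d [dp Hd]].
    exists (Rmin d d0); split; [apply Rmin_pos; assumption|].
    intros w Hw. specialize (Hd w (Rlt_le_trans _ _ _ Hw (Rmin_l _ _))).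
    rewrite (E w (Rlt_le_trans _ _ _ Hw (Rmin_r _ _))).
    replace (f z + g w * (w - z) - f z - g z * (w - z))%C
      with ((g w - g z) * (w - z))%C by ring.
    rewrite Cmod_mult. apply Rmult_le_compat_r; [apply Cmod_ge_0|lra].
Qed.

Lemma cder_ccont (f : C -> C) (z l : C) : cder f z l -> ccont f z.
Proof.
  intros H. apply cder_iff_slope in H. destruct H as [g [Hg [_ [d [dp E]]]]].
  apply ccont_ext_loc with (fun w => f z + g w * (w + (-z)))%C d; auto.
  { intros w Hw. rewrite (E w Hw). ring. }
  apply ccont_plus; [apply ccont_const|]. apply ccont_mult; auto.
  apply ccont_plus; [apply ccont_id|apply ccont_const].
Qed.

Lemma cder_ext_loc (f g : C -> C) (z l : C) (r : R) : 0 < r ->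
  (forall w, Cmod (w - z) < r -> f w = g w) -> cder f z l -> cder g z l.
Proof.
  intros hr E. rewrite !cder_iff_eps. intros H e he.
  destruct (H e he) as [d [d0 Hd]].
  exists (Rmin d r); split; [apply Rmin_pos; assumption|].
  intros w Hw. rewrite <- !E.
  - apply Hd. eapply Rlt_le_trans; [exact Hw|apply Rmin_l].
  - replace (z - z)%C with (RtoC 0) by ring. rewrite Cmod_0; lra.
  - eapply Rlt_le_trans; [exact Hw|apply Rmin_r].
Qed.

Lemma cder_const (c z : C) : cder (fun _ => c) z (RtoC 0).
Proof. apply (is_derive_const (K:=C_AbsRing) (V:=C_NormedModule)). Qed.

Lemma cder_id (z : C) : cder (fun w => w) z (RtoC 1).
Proof.
  apply cder_iff_slope. exists (fun _ => RtoC 1).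
  split; [apply ccont_const|]. split; [reflexivity|].
  exists 1; split; [lra|]. intros; ring.
Qed.

Lemma cder_plus (f g : C -> C) (z l m : C) :
  cder f z l -> cder g z m -> cder (fun w => f w + g w)%C z (l + m)%C.
Proof. intros; apply (is_derive_plus (K:=C_AbsRing) (V:=C_NormedModule)); assumption. Qed.

Lemma cder_mult (f g : C -> C) (z l m : C) :
  cder f z l -> cder g z m -> cder (fun w => f w * g w)%C z (l * g z + f z * m)%C.
Proof.
  intros Hf Hg.
  pose proof (cder_ccont _ _ _ Hg) as cg.
  apply cder_iff_slope in Hf. destruct Hf as [k1 [K1 [<- [d1 [d1p E1]]]]].
  apply cder_iff_slope in Hg. destruct Hg as [k2 [K2 [<- [d2 [d2p E2]]]]].
  apply cder_iff_slope.
  exists (fun w => k1 w * g w + f z * k2 w)%C. split; [|split; [reflexivity|]].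
  - apply ccont_plus; apply ccont_mult; auto. apply ccont_const.
  - exists (Rmin d1 d2); split; [apply Rmin_pos; assumption|]. intros w Hw.
    rewrite (E1 w (Rlt_le_trans _ _ _ Hw (Rmin_l _ _))).
    rewrite (E2 w (Rlt_le_trans _ _ _ Hw (Rmin_r _ _))). ring.
Qed.

Lemma cder_comp (f g : C -> C) (z l m : C) :
  cder f (g z) l -> cder g z m -> cder (fun w => f (g w)) z (l * m)%C.
Proof.
  intros Hf Hg.
  pose proof (cder_ccont _ _ _ Hg) as cg.
  apply cder_iff_slope in Hf. destruct Hf as [k1 [K1 [<- [d1 [d1p E1]]]]].
  apply cder_iff_slope in Hg. destruct Hg as [k2 [K2 [<- [d2 [d2p E2]]]]].
  apply cder_iff_slope.
  exists (fun w => k1 (g w) * k2 w)%C. split; [|split; [reflexivity|]].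
  - apply ccont_mult; auto. apply ccont_comp; auto.
  - destruct (cg d1 d1p) as [d3 [d3p H3]].
    exists (Rmin d3 d2); split; [apply Rmin_pos; assumption|]. intros w Hw.
    rewrite (E1 (g w)) by (apply H3; exact (Rlt_le_trans _ _ _ Hw (Rmin_l _ _))).
    rewrite (E2 w (Rlt_le_trans _ _ _ Hw (Rmin_r _ _))) at 2. ring.
Qed.

Lemma cder_inv (f : C -> C) (z l : C) : cder f z l -> f z <> RtoC 0 ->
  cder (fun w => / f w)%C z (- l / (f z * f z))%C.
Proof.
  intros Hf n.
  pose proof (cder_ccont _ _ _ Hf) as cf.
  apply cder_iff_slope in Hf. destruct Hf as [k1 [K1 [<- [d1 [d1p E1]]]]].
  apply cder_iff_slope.
  exists (fun w => ((- (1)) * k1 w) * / (f z * f w))%C. split; [|split].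
  - apply ccont_mult; [apply ccont_mult; auto; apply ccont_const|].
    apply ccont_inv; [|apply Cmult_neq_0; assumption].
    apply ccont_mult; auto; apply ccont_const.
  - field. auto.
  - destruct (ccont_away f z cf n) as [d2 [d2p H2]].
    exists (Rmin d1 d2); split; [apply Rmin_pos; assumption|]. intros w Hw.
    specialize (H2 w (Rlt_le_trans _ _ _ Hw (Rmin_r _ _))).
    specialize (E1 w (Rlt_le_trans _ _ _ Hw (Rmin_l _ _))).
    assert (nw : f w <> RtoC 0).
    { intros E. rewrite E, Cmod_0 in H2. pose proof (Cmod_ge_0 (f z)). lra. }
    assert (E : (k1 w * (w - z) = f w - f z)%C) by (rewrite E1; ring).
    transitivity (/ f z + - (k1 w * (w - z)) * / (f z * f w))%C; [|ring].
    rewrite E. field. auto.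
Qed.

Lemma cder_eq (f : C -> C) (z l m : C) : cder f z l -> l = m -> cder f z m.
Proof. intros H <-. exact H. Qed.

(** * The exponential, the logarithm and q_s *)

Lemma Cmod_le_abs (x y : R) : Cmod (x, y) <= Rabs x + Rabs y.
Proof.
  apply Rsqr_incr_0_var; [|pose proof (Rabs_pos x); pose proof (Rabs_pos y); lra].
  unfold Cmod, Rsqr. simpl fst; simpl snd. rewrite sqrt_sqrt by nra.
  pose proof (Rabs_pos x); pose proof (Rabs_pos y).
  pose proof (Rsqr_abs x); pose proof (Rsqr_abs y). unfold Rsqr in *. nra.
Qed.

Lemma abs_Re (z : C) : Rabs (Re z) <= Cmod z.
Proof. eapply Rle_trans; [|apply Rmax_Cmod]. apply Rmax_l. Qed.
Lemma abs_Im (z : C) : Rabs (Im z) <= Cmod z.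
Proof. eapply Rle_trans; [|apply Rmax_Cmod]. apply Rmax_r. Qed.

Lemma Cmod_le_2max (z : C) : Cmod z <= 2 * Rmax (Rabs (Re z)) (Rabs (Im z)).
Proof.
  destruct z as [x y]; simpl. pose proof (Cmod_le_abs x y).
  pose proof (Rmax_l (Rabs x) (Rabs y)). pose proof (Rmax_r (Rabs x) (Rabs y)). lra.
Qed.

(** Cauchy-Riemann: real differentiability with a conformal differential is
    complex differentiability. *)
Lemma cder_of_CR (f : C -> C) (x y a b : R) :
  differentiable_pt_lim (fun u v => Re (f (u, v))) x y a (- b) ->
  differentiable_pt_lim (fun u v => Im (f (u, v))) x y b a ->
  cder f (x, y) (a, b).
Proof.
  intros HR HI. apply cder_iff_eps. intros e he.
  destruct (HR (mkposreal (e/2) ltac:(lra))) as [d1 H1].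
  destruct (HI (mkposreal (e/2) ltac:(lra))) as [d2 H2].
  exists (Rmin d1 d2); split; [apply Rmin_pos; apply cond_pos|].
  intros [u v] Hw.
  pose proof (abs_Re ((u, v) - (x, y))%C) as hu.
  pose proof (abs_Im ((u, v) - (x, y))%C) as hv.
  pose proof (Rmin_l d1 d2). pose proof (Rmin_r d1 d2).
  simpl Re in hu. simpl Im in hv.
  change (u + - x) with (u - x) in hu. change (v + - y) with (v - y) in hv.
  specialize (H1 u v ltac:(lra) ltac:(lra)). specialize (H2 u v ltac:(lra) ltac:(lra)).
  simpl pos in H1, H2.
  set (m := Rmax (Rabs (u - x)) (Rabs (v - y))) in *.
  assert (hm : m <= Cmod ((u, v) - (x, y))) by (apply Rmax_case; assumption).
  eapply Rle_trans; [apply (Cmod_le_abs (Re _) (Im _))|].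
  simpl.
  replace (Rabs _) with (Rabs (Re (f (u, v)) - Re (f (x, y)) - (a * (u - x) + - b * (v - y))))
    by (f_equal; unfold Re; ring).
  match goal with |- _ + Rabs ?t <= _ =>
    replace (Rabs t) with (Rabs (Im (f (u, v)) - Im (f (x, y)) - (b * (u - x) + a * (v - y))))
    by (f_equal; unfold Im; ring) end.
  apply Rle_trans with (e * m); [lra|]. apply Rmult_le_compat_l; lra.
Qed.

Lemma CR_of_cder (f : C -> C) (x y : R) (l : C) : cder f (x, y) l ->
  differentiable_pt_lim (fun u v => Re (f (u, v))) x y (Re l) (- Im l) /\
  differentiable_pt_lim (fun u v => Im (f (u, v))) x y (Im l) (Re l).
Proof.
  intros H. rewrite cder_iff_eps in H.
  assert (K : forall e, 0 < e -> exists d, 0 < d /\ forall u v,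
    Rabs (u - x) < d -> Rabs (v - y) < d ->
    Cmod (f (u, v) - f (x, y) - l * ((u, v) - (x, y))) <=
      e * Rmax (Rabs (u - x)) (Rabs (v - y))).
  { intros e he. destruct (H (e / 2) ltac:(lra)) as [d [dp Hd]].
    exists (d / 2); split; [lra|]. intros u v hu hv.
    pose proof (Cmod_le_2max ((u, v) - (x, y))%C) as hm. simpl Re in hm; simpl Im in hm.
    change (u + - x) with (u - x) in hm. change (v + - y) with (v - y) in hm.
    assert (Rmax (Rabs (u - x)) (Rabs (v - y)) < d / 2) by (apply Rmax_case; assumption).
    eapply Rle_trans; [apply Hd; lra|].
    apply Rle_trans with (e / 2 * (2 * Rmax (Rabs (u - x)) (Rabs (v - y)))); [|lra].
    apply Rmult_le_compat_l; lra. }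
  split; intros e; destruct (K e (cond_pos e)) as [d [dp Hd]];
    exists (mkposreal d dp); intros u v hu hv; specialize (Hd u v hu hv).
  - eapply Rle_trans; [|exact Hd]. eapply Rle_trans; [|apply abs_Re].
    right; f_equal. destruct l, (f (u, v)), (f (x, y)); simpl; ring.
  - eapply Rle_trans; [|exact Hd]. eapply Rle_trans; [|apply abs_Im].
    right; f_equal. destruct l, (f (u, v)), (f (x, y)); simpl; ring.
Qed.

Lemma diff2_fst (x y : R) : differentiable_pt_lim (fun u _ => u) x y 1 0.
Proof. apply (differentiable_pt_lim_proj1_0 (fun u => u)). apply derivable_pt_lim_id. Qed.

Lemma diff2_snd (x y : R) : differentiable_pt_lim (fun _ v => v) x y 0 1.
Proof.
  intros e; exists (mkposreal 1 Rlt_0_1); intros u v _ _.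
  replace (v - y - (0 * (u - x) + 1 * (v - y))) with 0 by ring.
  rewrite Rabs_R0. apply Rmult_le_pos; [left; apply cond_pos|].
  eapply Rle_trans; [apply Rabs_pos|apply Rmax_l].
Qed.

Lemma diff2_mult_pt (x y : R) : differentiable_pt_lim Rmult x y y x.
Proof.
  intros e; exists e; intros u v hu hv.
  replace (u * v - x * y - (y * (u - x) + x * (v - y))) with ((u - x) * (v - y)) by ring.
  rewrite Rabs_mult. apply Rmult_le_compat; try apply Rabs_pos; [lra|apply Rmax_r].
Qed.

Lemma diff2_plus_pt (x y : R) : differentiable_pt_lim Rplus x y 1 1.
Proof.
  intros e; exists e; intros u v hu hv.
  replace (u + v - (x + y) - (1 * (u - x) + 1 * (v - y))) with 0 by ring.
  rewrite Rabs_R0. apply Rmult_le_pos; [left; apply cond_pos|].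
  eapply Rle_trans; [apply Rabs_pos|apply Rmax_l].
Qed.

Lemma diff2_mult (f g : R -> R -> R) (x y fx fy gx gy : R) :
  differentiable_pt_lim f x y fx fy -> differentiable_pt_lim g x y gx gy ->
  differentiable_pt_lim (fun u v => f u v * g u v) x y
    (g x y * fx + f x y * gx) (g x y * fy + f x y * gy).
Proof. intros; apply (differentiable_pt_lim_comp Rmult); auto. apply diff2_mult_pt. Qed.

Lemma diff2_plus (f g : R -> R -> R) (x y fx fy gx gy : R) :
  differentiable_pt_lim f x y fx fy -> differentiable_pt_lim g x y gx gy ->
  differentiable_pt_lim (fun u v => f u v + g u v) x y
    (1 * fx + 1 * gx) (1 * fy + 1 * gy).
Proof. intros; apply (differentiable_pt_lim_comp Rplus); auto. apply diff2_plus_pt. Qed.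

Lemma diff2_comp1 (F : R -> R) (g : R -> R -> R) (x y gx gy l : R) :
  derivable_pt_lim F (g x y) l -> differentiable_pt_lim g x y gx gy ->
  differentiable_pt_lim (fun u v => F (g u v)) x y (l * gx + 0 * gx) (l * gy + 0 * gy).
Proof.
  intros HF Hg. apply (differentiable_pt_lim_comp (fun u _ => F u) g g); auto.
  apply differentiable_pt_lim_proj1_0; exact HF.
Qed.

Lemma diff2_eq (f : R -> R -> R) (x y a b a' b' : R) :
  differentiable_pt_lim f x y a b -> a = a' -> b = b' -> differentiable_pt_lim f x y a' b'.
Proof. intros H <- <-; exact H. Qed.

Lemma cder_Cexp (z : C) : cder Cexp z (Cexp z).
Proof.
  destruct z as [x y]. unfold Cexp at 2. simpl Re; simpl Im.
  pose proof (diff2_comp1 exp _ x y _ _ _ (derivable_pt_lim_exp x) (diff2_fst x y)) as He.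
  pose proof (diff2_comp1 cos _ x y _ _ _ (derivable_pt_lim_cos y) (diff2_snd x y)) as Hc.
  pose proof (diff2_comp1 sin _ x y _ _ _ (derivable_pt_lim_sin y) (diff2_snd x y)) as Hs.
  apply cder_of_CR; unfold Cexp; simpl.
  - eapply diff2_eq; [apply (diff2_mult _ _ _ _ _ _ _ _ He Hc)| |]; ring.
  - eapply diff2_eq; [apply (diff2_mult _ _ _ _ _ _ _ _ He Hs)| |]; ring.
Qed.

Lemma cder_Clog_right (w : C) : 0 < Re w -> cder Clog_right w (/ w)%C.
Proof.
  destruct w as [x y]. simpl Re. intros hx.
  assert (hm : 0 < x * x + y * y) by nra.
  assert (Hsq : forall u v, Cmod (u, v) = sqrt (u * u + v * v)).
  { intros; unfold Cmod; f_equal; simpl; ring. }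
  unfold Cinv. simpl fst; simpl snd.
  apply cder_of_CR; unfold Clog_right; simpl Re; simpl Im.
  - apply differentiable_pt_lim_ext with (fun u v => ln (sqrt (u * u + v * v))).
    { exists (mkposreal 1 Rlt_0_1). intros u v _ _. rewrite Hsq. reflexivity. }
    pose proof (diff2_plus _ _ _ _ _ _ _ _
      (diff2_mult _ _ _ _ _ _ _ _ (diff2_fst x y) (diff2_fst x y))
      (diff2_mult _ _ _ _ _ _ _ _ (diff2_snd x y) (diff2_snd x y))) as H1.
    pose proof (diff2_comp1 sqrt _ x y _ _ _ (derivable_pt_lim_sqrt _ hm) H1) as H2.
    pose proof (diff2_comp1 ln _ x y _ _ _ (derivable_pt_lim_ln _ (sqrt_lt_R0 _ hm)) H2) as H3.
    assert (sqrt (x * x + y * y) <> 0) by (apply Rgt_not_eq, sqrt_lt_R0; exact hm).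
    assert (E : sqrt (x * x + y * y) * sqrt (x * x + y * y) = x * x + y * y)
      by (apply sqrt_sqrt; lra).
    eapply diff2_eq; [exact H3| |]; cbv beta.
    + transitivity (x / (sqrt (x * x + y * y) * sqrt (x * x + y * y))); [field; auto|].
      rewrite E. field. nra.
    + transitivity (y / (sqrt (x * x + y * y) * sqrt (x * x + y * y))); [field; auto|].
      rewrite E. field. nra.
  - assert (Hi : derivable_pt_lim (fun u => / u) x (- / (x * x))).
    { apply is_derive_Reals. auto_derive; [lra|]. field; lra. }
    pose proof (diff2_comp1 (fun u => / u) _ x y _ _ _ Hi (diff2_fst x y)) as H1.
    pose proof (diff2_mult _ _ _ _ _ _ _ _ (diff2_snd x y) H1) as H2.
    pose proof (diff2_comp1 atan _ x y _ _ _ (derivable_pt_lim_atan (y * / x)) H2) as H3.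
    eapply diff2_eq; [exact H3| |]; cbv beta; field; split; nra.
Qed.

Lemma Cexp_plus (a b : C) : Cexp (a + b) = (Cexp a * Cexp b)%C.
Proof.
  destruct a as [a1 a2], b as [b1 b2]. unfold Cexp, Cmult, Cplus. simpl.
  rewrite exp_plus, cos_plus, sin_plus. f_equal; ring.
Qed.

Lemma Cexp_0 : Cexp (RtoC 0) = RtoC 1.
Proof. unfold Cexp, RtoC; simpl. rewrite exp_0, cos_0, sin_0. f_equal; ring. Qed.

Lemma Cexp_neq_0 (z : C) : Cexp z <> RtoC 0.
Proof.
  intros E. pose proof (Cexp_plus z (- z)) as H. rewrite E in H.
  replace (z + - z)%C with (RtoC 0) in H by ring. rewrite Cexp_0, Cmult_0_l in H.
  apply RtoC_inj in H. lra.
Qed.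

Lemma disk_re (z : C) : in_disk z -> 0 < Re (1 - z)%C.
Proof.
  unfold in_disk; intros H. pose proof (abs_Re z). destruct z as [x y]; simpl in *.
  pose proof (Rle_abs x). lra.
Qed.

Lemma disk_1m_neq_0 (z : C) : in_disk z -> (1 - z)%C <> RtoC 0.
Proof. intros H E. apply disk_re in H. rewrite E in H. simpl in H. lra. Qed.

Lemma q_hpl_0 (s : R) : q_hpl s (RtoC 0) = RtoC 1.
Proof.
  unfold q_hpl, Clog_right.
  replace (1 - 0)%C with (RtoC 1) by ring. rewrite Cmod_1, ln_1.
  replace (Im 1 / Re 1) with 0 by (simpl; field). rewrite atan_0.
  change (0, 0) with (RtoC 0). rewrite <- Cexp_0. f_equal. ring.
Qed.

Lemma q_hpl_neq_0 (s : R) (z : C) : q_hpl s z <> RtoC 0.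
Proof. apply Cexp_neq_0. Qed.

Lemma cder_q_hpl (s : R) (z : C) : in_disk z ->
  cder (q_hpl s) z (RtoC s * q_hpl s z / (1 - z))%C.
Proof.
  intros hz. unfold q_hpl.
  eapply cder_eq.
  - apply (cder_comp Cexp); [apply cder_Cexp|].
    apply (cder_ext_loc (fun w => (- RtoC s) * Clog_right (1 + (- (1)) * w))%C _ z _ 1 Rlt_0_1).
    { intros w _. replace (1 - w)%C with (1 + (- (1)) * w)%C by ring. ring. }
    apply (cder_mult (fun _ => - RtoC s)%C); [apply cder_const|].
    apply (cder_comp Clog_right (fun w => 1 + (- (1)) * w)%C).
    + apply cder_Clog_right.
      replace (1 + - (1) * z)%C with (1 - z)%C by ring. apply disk_re, hz.
    + apply cder_plus; [apply cder_const|]. apply cder_mult; [apply cder_const|apply cder_id].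
  - replace (1 + - (1) * z)%C with (1 - z)%C by ring. field. apply disk_1m_neq_0, hz.
Qed.

(** The argument of (1 - z)^(-s) is s times an angle below pi / 2 in modulus. *)
Lemma Re_q_hpl_pos (s : R) (z : C) : 0 < s <= 1 -> 0 < Re (q_hpl s z).
Proof.
  intros hs. unfold q_hpl. set (L := Clog_right (1 - z)).
  assert (HL : - PI / 2 < Im L < PI / 2) by apply atan_bound.
  change (0 < exp (Re (- (s * L))) * cos (Im (- (s * L)))).
  apply Rmult_lt_0_compat; [apply exp_pos|].
  replace (Im (- (s * L))) with (- (s * Im L)) by (destruct L; simpl; ring).
  rewrite cos_neg. apply cos_gt_0; nra.
Qed.

(** * Mean value theorems along segments *)

Lemma deriv_along (f : C -> C) (p1 p2 : R -> R) (t a b : R) (l : C) :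
  cder f (p1 t, p2 t) l -> is_derive p1 t a -> is_derive p2 t b ->
  is_derive (fun t => Re (f (p1 t, p2 t))) t (Re (l * (a, b))) /\
  is_derive (fun t => Im (f (p1 t, p2 t))) t (Im (l * (a, b))).
Proof.
  intros Hf H1 H2. destruct (CR_of_cder _ _ _ _ Hf) as [HR HI].
  apply is_derive_Reals in H1. apply is_derive_Reals in H2.
  split; apply is_derive_Reals.
  - replace (Re (l * (a, b))) with (Re l * a + (- Im l) * b) by (destruct l; simpl; ring).
    apply (derivable_pt_lim_comp_2d (fun u v => Re (f (u, v)))); assumption.
  - replace (Im (l * (a, b))) with (Im l * a + Re l * b) by (destruct l; simpl; ring).
    apply (derivable_pt_lim_comp_2d (fun u v => Im (f (u, v)))); assumption.
Qed.

(** The mean value theorem fails for complex values, so functions are seen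
    through the real functionals w |-> Re (k w). *)
Lemma deriv_segment (f : C -> C) (z d l k : C) (t : R) :
  cder f (z + RtoC t * d)%C l ->
  is_derive (fun t => Re (k * f (z + RtoC t * d))%C) t (Re (k * (l * d))%C).
Proof.
  intros H. destruct z as [zx zy], d as [dx dy].
  assert (E : forall t, ((zx, zy) + RtoC t * (dx, dy))%C = (zx + t * dx, zy + t * dy)).
  { intros u. unfold Cplus, Cmult, RtoC; simpl. f_equal; ring. }
  rewrite E in H.
  assert (Hk : cder (fun w => k * f w)%C (zx + t * dx, zy + t * dy) (k * l)%C).
  { eapply cder_eq; [apply (cder_mult (fun _ => k)); [apply cder_const|exact H]|]. ring. }
  apply (is_derive_ext (fun t => Re (k * f ((zx + t * dx)%R, (zy + t * dy)%R))%C)).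
  { intros u. rewrite E. reflexivity. }
  replace (k * (l * (dx, dy)))%C with ((k * l) * (dx, dy))%C by ring.
  apply (deriv_along (fun w => k * f w)%C (fun t => zx + t * dx) (fun t => zy + t * dy)
    t dx dy); auto; auto_derive; auto; ring.
Qed.

Lemma mvt_segment (f f' : C -> C) (z d k : C) :
  (forall t, 0 <= t <= 1 -> cder f (z + RtoC t * d)%C (f' (z + RtoC t * d)%C)) ->
  exists t, 0 <= t <= 1 /\
    Re (k * (f (z + d) - f z))%C = Re (k * (f' (z + RtoC t * d) * d))%C.
Proof.
  intros H.
  destruct (MVT_gen (fun t => Re (k * f (z + RtoC t * d))%C) 0 1
    (fun t => Re (k * (f' (z + RtoC t * d) * d))%C)) as [c [hc E]].
  - rewrite Rmin_left, Rmax_right by lra. intros x hx. apply deriv_segment, H. lra.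
  - rewrite Rmin_left, Rmax_right by lra. intros x hx.
    apply derivable_continuous_pt. eexists. apply is_derive_Reals.
    apply deriv_segment, H. lra.
  - rewrite Rmin_left, Rmax_right in hc by lra. exists c; split; [exact hc|].
    rewrite Rminus_0_r, Rmult_1_r in E. rewrite <- E.
    replace (z + RtoC 1 * d)%C with (z + d)%C by ring.
    replace (z + RtoC 0 * d)%C with z by ring.
    generalize (f (z + d)%C) (f z). intros p q. destruct k, p, q; simpl; ring.
Qed.

Lemma Cmod_sqr_Re (x : C) : Re (Cconj x * x)%C = Cmod x * Cmod x.
Proof.
  unfold Cmod. rewrite sqrt_sqrt by (destruct x; simpl; nra). destruct x; simpl; ring.
Qed.

(** The functional k = conj (f(z + d) - f(z)) turns the mean value theorem into
    a bound on the increment itself. *)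
Lemma mvi_segment (f f' : C -> C) (z d : C) (M : R) :
  (forall t, 0 <= t <= 1 -> cder f (z + RtoC t * d)%C (f' (z + RtoC t * d)%C)) ->
  (forall t, 0 <= t <= 1 -> Cmod (f' (z + RtoC t * d)%C) <= M) ->
  Cmod (f (z + d)%C - f z) <= M * Cmod d.
Proof.
  intros H HM. set (D := (f (z + d)%C - f z)%C).
  destruct (mvt_segment f f' z d (Cconj D) H) as [t [ht E]]. fold D in E.
  rewrite Cmod_sqr_Re in E.
  pose proof (Rle_trans _ _ _ (Rle_abs _) (abs_Re (Cconj D * (f' (z + RtoC t * d) * d))%C)) as L.
  rewrite <- E, !Cmod_mult, Cmod_conj in L. specialize (HM t ht).
  pose proof (Cmod_ge_0 D) as h0. pose proof (Cmod_ge_0 d).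
  destruct h0 as [h0|h0].
  - apply Rmult_le_reg_l with (Cmod D); [exact h0|]. eapply Rle_trans; [exact L|].
    apply Rmult_le_compat_l; [lra|]. apply Rmult_le_compat_r; assumption.
  - rewrite <- h0. apply Rmult_le_pos; [|assumption].
    eapply Rle_trans; [apply Cmod_ge_0|exact HM].
Qed.

Lemma in_disk_scale (z : C) (t : R) : in_disk z -> 0 <= t <= 1 -> in_disk (RtoC t * z)%C.
Proof.
  unfold in_disk; intros hz ht. rewrite Cmod_mult, Cmod_R, Rabs_pos_eq by lra.
  pose proof (Cmod_ge_0 z). nra.
Qed.

Lemma zero_derivative_const (f : C -> C) :
  (forall z, in_disk z -> cder f z (RtoC 0)) -> forall z, in_disk z -> f z = f (RtoC 0).
Proof.
  intros H z hz.
  assert (L : Cmod (f (0 + z) - f 0)%C <= 0 * Cmod z).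
  { apply (mvi_segment f (fun _ => RtoC 0)); intros t ht.
    - apply H. replace (0 + RtoC t * z)%C with (RtoC t * z)%C by ring.
      apply in_disk_scale; assumption.
    - rewrite Cmod_0; lra. }
  rewrite Rmult_0_l in L. replace (0 + z)%C with z in L by ring.
  assert (E : Cmod (f z - f 0)%C = 0) by (pose proof (Cmod_ge_0 (f z - f 0)%C); lra).
  apply Cmod_eq_0 in E. replace (f z) with ((f z - f 0) + f 0)%C by ring. rewrite E. ring.
Qed.

(** Two solutions of the linear equation f' = g f that agree at the origin have
    a constant quotient. *)
Lemma linear_ode_unique (f e g : C -> C) :
  (forall z, in_disk z -> cder f z (g z * f z)%C) ->
  (forall z, in_disk z -> cder e z (g z * e z)%C) ->
  (forall z, in_disk z -> e z <> RtoC 0) -> f (RtoC 0) = e (RtoC 0) ->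
  forall z, in_disk z -> f z = e z.
Proof.
  intros Hf He ne E0 z hz.
  assert (h0 : in_disk (RtoC 0)) by (unfold in_disk; rewrite Cmod_0; lra).
  assert (K : (f z * / e z = f (RtoC 0) * / e (RtoC 0))%C).
  { apply (zero_derivative_const (fun z => f z * / e z)%C); auto. intros w hw.
    eapply cder_eq; [apply cder_mult; [apply Hf, hw|apply cder_inv; [apply He, hw|auto]]|].
    simpl. field. auto. }
  rewrite E0, Cinv_r in K by auto.
  replace (f z) with (f z * / e z * e z)%C by (field; auto). rewrite K. ring.
Qed.

(** * Complex power series *)

(** Convergence of a complex series, by components: limits, algebra and Cauchy
    products are then inherited from real series. *)
Definition csum (x : nat -> C) (l : C) : Prop :=
  is_series (fun n => Re (x n)) (Re l) /\ is_series (fun n => Im (x n)) (Im l).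

Lemma sum_n_Re (x : nat -> C) (n : nat) :
  Re (@sum_n C_AbelianMonoid x n) = sum_n (fun k => Re (x k)) n.
Proof.
  induction n; [rewrite !sum_O; reflexivity|]. rewrite !sum_Sn, <- IHn. reflexivity.
Qed.

Lemma sum_n_Im (x : nat -> C) (n : nat) :
  Im (@sum_n C_AbelianMonoid x n) = sum_n (fun k => Im (x k)) n.
Proof.
  induction n; [rewrite !sum_O; reflexivity|]. rewrite !sum_Sn, <- IHn. reflexivity.
Qed.

Lemma csum_is_series (x : nat -> C) (l : C) :
  csum x l <-> @is_series C_AbsRing C_NormedModule x l.
Proof.
  unfold csum, is_series. split.
  - intros [HR HI]. apply (filterlim_locally (U := C_UniformSpace)). intros e.
    pose proof (proj1 (filterlim_locally (U := R_UniformSpace) _ _) HR e) as HR'.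
    pose proof (proj1 (filterlim_locally (U := R_UniformSpace) _ _) HI e) as HI'.
    clear HR HI. rename HR' into HR, HI' into HI.
    generalize (filter_and _ _ HR HI). apply filter_imp. intros n [h1 h2].
    split; [|].
    + change (ball (Re l) e (Re (@sum_n C_AbelianMonoid x n))). rewrite sum_n_Re. exact h1.
    + change (ball (Im l) e (Im (@sum_n C_AbelianMonoid x n))). rewrite sum_n_Im. exact h2.
  - intros H. pose proof (proj1 (filterlim_locally (U := C_UniformSpace) _ _) H) as H'.
    split; apply (filterlim_locally (U := R_UniformSpace)); intros e; generalize (H' e); apply filter_imp;
      intros n [h1 h2].
    + rewrite <- sum_n_Re. exact h1.
    + rewrite <- sum_n_Im. exact h2.
Qed.

Lemma csum_unique (x : nat -> C) (l m : C) : csum x l -> csum x m -> l = m.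
Proof.
  intros [h1 h2] [h3 h4]. apply is_series_unique in h1, h2, h3, h4.
  destruct l, m. simpl in *. congruence.
Qed.

Lemma csum_ext (x y : nat -> C) (l : C) : (forall n, x n = y n) -> csum x l -> csum y l.
Proof.
  intros E [h1 h2]. split; eapply is_series_ext; eauto; intros n; simpl; rewrite E; reflexivity.
Qed.

Lemma csum_plus (x y : nat -> C) (l m : C) :
  csum x l -> csum y m -> csum (fun n => x n + y n)%C (l + m)%C.
Proof. intros [h1 h2] [h3 h4]. split; apply (is_series_plus (V := R_NormedModule)); assumption. Qed.

Lemma csum_scal (k : C) (x : nat -> C) (l : C) :
  csum x l -> csum (fun n => k * x n)%C (k * l)%C.
Proof.
  intros [h1 h2]. split; simpl.
  - apply (is_series_minus (V := R_NormedModule));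
      apply (is_series_scal (V := R_NormedModule)); assumption.
  - apply (is_series_plus (V := R_NormedModule));
      apply (is_series_scal (V := R_NormedModule)); assumption.
Qed.

Lemma csum_incr (x : nat -> C) (l : C) :
  csum (fun n => x (S n)) l -> csum x (x 0%nat + l)%C.
Proof.
  intros [h1 h2]. split; simpl.
  - apply (is_series_decr_1 (V := R_NormedModule)).
    match goal with |- is_series _ ?t => replace t with (Re l) end; [exact h1|].
    change (Re l = (Re (x 0%nat) + Re l) + - Re (x 0%nat)). ring.
  - apply (is_series_decr_1 (V := R_NormedModule)).
    match goal with |- is_series _ ?t => replace t with (Im l) end; [exact h2|].
    change (Im l = (Im (x 0%nat) + Im l) + - Im (x 0%nat)). ring.
Qed.

Lemma is_series_R_le (x y : nat -> R) (l m : R) :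
  (forall n, x n <= y n) -> is_series x l -> is_series y m -> l <= m.
Proof.
  intros H h1 h2. apply (is_lim_seq_le (sum_n x) (sum_n y) l m); auto.
  intros n. apply sum_n_m_le. exact H.
Qed.

Lemma is_series_nonneg (b : nat -> R) (B : R) : (forall n, 0 <= b n) -> is_series b B -> 0 <= B.
Proof.
  intros H HB. apply (is_lim_seq_le (fun _ => 0) (sum_n b) 0 B); auto.
  - intros n. rewrite sum_n_Reals. apply cond_pos_sum, H.
  - apply is_lim_seq_const.
Qed.

(** The sum l is tested against its own conjugate, which makes |l|^2 a real
    series dominated by |l| b. *)
Lemma csum_bound (x : nat -> C) (l : C) (b : nat -> R) (B : R) :
  csum x l -> (forall n, Cmod (x n) <= b n) -> is_series b B -> Cmod l <= B.
Proof.
  intros H hb HB. pose proof (csum_scal (Cconj l) _ _ H) as [h _].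
  rewrite Cmod_sqr_Re in h.
  assert (L : Cmod l * Cmod l <= Cmod l * B).
  { apply (is_series_R_le (fun n => Re (Cconj l * x n)%C) (fun n => Cmod l * b n)); auto.
    - intros n.
      eapply Rle_trans; [eapply Rle_trans; [apply Rle_abs|apply (abs_Re (Cconj l * x n)%C)]|].
      rewrite Cmod_mult, Cmod_conj. apply Rmult_le_compat_l; [apply Cmod_ge_0|apply hb].
    - apply (is_series_scal (V := R_NormedModule)). exact HB. }
  assert (0 <= B).
  { apply (is_series_nonneg b); auto.
    intros n. eapply Rle_trans; [apply Cmod_ge_0|apply hb]. }
  destruct (Cmod_ge_0 l) as [p|p]; [|lra].
  apply Rmult_le_reg_l with (Cmod l); assumption.
Qed.

Lemma csum_ex (x : nat -> C) (b : nat -> R) :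
  (forall n, Cmod (x n) <= b n) -> ex_series b ->
  csum x (Series (fun n => Re (x n)), Series (fun n => Im (x n))).
Proof.
  intros H hb. split; simpl; apply Series_correct;
    apply (ex_series_le (V := R_CompleteNormedModule) _ b); auto; intros n;
    (eapply Rle_trans; [|apply H]); [apply (abs_Re (x n))|apply (abs_Im (x n))].
Qed.

(** Convergence in the whole unit disk, expressed by Cauchy's estimates: in this
    form it passes at once to shifted and to differentiated series. *)
Definition disk_coef (a : nat -> C) : Prop :=
  forall r, 0 < r < 1 -> exists M, forall n, Cmod (a n) * r ^ n <= M.

Definition shift (a : nat -> C) (n : nat) : C := a (S n).
Definition deriv_coef (a : nat -> C) (n : nat) : C := (RtoC (INR (S n)) * a (S n))%C.

Definition CPS (a : nat -> C) (z : C) : C :=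
  (Series (fun n => Re (a n * z ^ n)%C), Series (fun n => Im (a n * z ^ n)%C)).

Lemma Cmod_pow (z : C) (n : nat) : Cmod (z ^ n)%C = Cmod z ^ n.
Proof.
  induction n; simpl; [apply Cmod_1|]. rewrite Cmod_mult, IHn. reflexivity.
Qed.

Lemma disk_coef_series (a : nat -> C) (r : R) : disk_coef a -> 0 <= r < 1 ->
  ex_series (fun n => Cmod (a n) * r ^ n).
Proof.
  intros H hr. set (p := (1 + r) / 2).
  destruct (H p ltac:(unfold p; lra)) as [M HM].
  assert (hp : 0 < p) by (unfold p; lra).
  apply (ex_series_le (V := R_CompleteNormedModule) _ (fun n => M * (r / p) ^ n)).
  - intros n. unfold norm; simpl. unfold abs; simpl.
    rewrite Rabs_pos_eq by (apply Rmult_le_pos; [apply Cmod_ge_0|apply pow_le; lra]).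
    replace (Cmod (a n) * r ^ n) with (Cmod (a n) * p ^ n * (r / p) ^ n).
    + apply Rmult_le_compat_r; [apply pow_le, Rdiv_le_0_compat; lra|apply HM].
    + rewrite Rmult_assoc, <- Rpow_mult_distr. do 2 f_equal. field. lra.
  - apply (ex_series_scal (V := R_NormedModule) M). apply ex_series_geom.
    rewrite Rabs_pos_eq by (apply Rdiv_le_0_compat; lra).
    apply Rmult_lt_reg_r with p; [lra|]. unfold Rdiv. rewrite Rmult_assoc, Rinv_l by lra.
    unfold p; lra.
Qed.

Lemma CPS_sum (a : nat -> C) (z : C) : disk_coef a -> in_disk z ->
  csum (fun n => a n * z ^ n)%C (CPS a z).
Proof.
  intros H hz. apply csum_ex with (fun n => Cmod (a n) * Cmod z ^ n).
  - intros n. rewrite Cmod_mult, Cmod_pow. lra.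
  - apply disk_coef_series; auto. split; [apply Cmod_ge_0|exact hz].
Qed.

Lemma pseries_term (a : nat -> C) (z : C) (n : nat) :
  scal (V := C_NormedModule) (pow_n (K := C_AbsRing) z n) (a n) = (a n * z ^ n)%C.
Proof.
  assert (E : pow_n (K := C_AbsRing) z n = (z ^ n)%C).
  { induction n; [reflexivity|]. simpl. rewrite IHn. reflexivity. }
  rewrite E. apply Cmult_comm.
Qed.

Lemma is_pseries_csum (a : nat -> C) (z l : C) :
  @is_pseries C_AbsRing C_NormedModule a z l <-> csum (fun n => a n * z ^ n)%C l.
Proof.
  unfold is_pseries. rewrite csum_is_series.
  split; apply is_series_ext; intros n; rewrite pseries_term; reflexivity.
Qed.

(** The terms of a convergent series at the real point r are bounded. *)
Lemma disk_coef_of_pseries (a : nat -> C) (f : C -> C) :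
  (forall z, in_disk z -> csum (fun n => a n * z ^ n)%C (f z)) -> disk_coef a.
Proof.
  intros H r hr.
  assert (hz : in_disk (RtoC r)) by (unfold in_disk; rewrite Cmod_R, Rabs_pos_eq; lra).
  destruct (H _ hz) as [h1 h2].
  destruct (filterlim_bounded (V := R_NormedModule) _
    (ex_intro _ 0 (ex_series_lim_0 _ (ex_intro _ _ h1)))) as [M1 H1].
  destruct (filterlim_bounded (V := R_NormedModule) _
    (ex_intro _ 0 (ex_series_lim_0 _ (ex_intro _ _ h2)))) as [M2 H2].
  exists (M1 + M2). intros n.
  replace (Cmod (a n) * r ^ n) with (Cmod (a n * RtoC r ^ n)%C).
  - eapply Rle_trans; [apply (Cmod_le_abs (Re _) (Im _))|]. apply Rplus_le_compat; [apply H1|apply H2].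
  - rewrite Cmod_mult, Cmod_pow, Cmod_R, Rabs_pos_eq by lra. reflexivity.
Qed.

Lemma CPS_unique (a : nat -> C) (z l : C) :
  csum (fun n => a n * z ^ n)%C l -> disk_coef a -> in_disk z -> CPS a z = l.
Proof. intros H Ha hz. eapply csum_unique; [apply CPS_sum; assumption|exact H]. Qed.

Lemma disk_coef_shift (a : nat -> C) : disk_coef a -> disk_coef (shift a).
Proof.
  intros H r hr. destruct (H r hr) as [M HM]. exists (M / r). intros n.
  apply Rmult_le_reg_r with r; [lra|]. unfold Rdiv. rewrite Rmult_assoc, Rmult_assoc, Rinv_l by lra.
  rewrite Rmult_1_r, (Rmult_comm _ r). apply (HM (S n)).
Qed.

Lemma disk_coef_deriv (a : nat -> C) : disk_coef a -> disk_coef (deriv_coef a).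
Proof.
  intros H r hr. set (p := (1 + r) / 2).
  destruct (disk_coef_shift a H p ltac:(unfold p; lra)) as [M HM].
  (* (n + 1) (r / p) ^ n is bounded, by Bernoulli's inequality *)
  set (h := p / r - 1).
  assert (hpr : r < p) by (unfold p; lra).
  assert (hh : 0 < h).
  { unfold h. apply Rmult_lt_reg_r with r; [lra|]. field_simplify; lra. }
  exists ((1 + / h) * M). intros n.
  unfold deriv_coef. rewrite Cmod_mult, Cmod_R, Rabs_pos_eq by apply pos_INR.
  specialize (HM n). unfold shift in HM.
  assert (hr0 : 0 < r ^ n) by (apply pow_lt; lra).
  assert (E : p ^ n = (1 + h) ^ n * r ^ n).
  { rewrite <- Rpow_mult_distr. f_equal. unfold h. field. lra. }
  pose proof (poly n h hh) as B. rewrite S_INR.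
  assert (K : INR n + 1 <= (1 + / h) * (1 + h) ^ n).
  { assert (1 <= (1 + h) ^ n) by (apply pow_R1_Rle; lra).
    assert (INR n <= / h * (1 + h) ^ n).
    { apply Rmult_le_reg_l with h; [lra|]. rewrite <- Rmult_assoc, Rinv_r by lra. lra. }
    lra. }
  rewrite E in HM. pose proof (Cmod_ge_0 (a (S n))).
  assert (0 < / h) by (apply Rinv_0_lt_compat; lra).
  apply Rle_trans with ((1 + / h) * (1 + h) ^ n * (Cmod (a (S n)) * r ^ n)).
  - rewrite Rmult_assoc. apply Rmult_le_compat_r; [apply Rmult_le_pos; lra|exact K].
  - rewrite Rmult_assoc. apply Rmult_le_compat_l; [lra|]. lra.
Qed.

Lemma disk_coef_of_shift (a : nat -> C) : disk_coef (shift a) -> disk_coef a.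
Proof.
  intros H r hr. destruct (H r hr) as [M HM]. exists (Cmod (a 0%nat) + M).
  assert (0 <= M).
  { eapply Rle_trans; [|apply (HM 0%nat)]. simpl. rewrite Rmult_1_r. apply Cmod_ge_0. }
  intros [|n]; [simpl; lra|].
  specialize (HM n). unfold shift in HM. pose proof (Cmod_ge_0 (a 0%nat)).
  assert (0 <= Cmod (a (S n)) * r ^ n).
  { apply Rmult_le_pos; [apply Cmod_ge_0|apply pow_le; lra]. }
  simpl pow. nra.
Qed.

Lemma CPS_decr (a : nat -> C) (z : C) : disk_coef a -> in_disk z ->
  CPS a z = (a 0%nat + z * CPS (shift a) z)%C.
Proof.
  intros H hz. apply CPS_unique; auto.
  pose proof (csum_incr (fun n => a n * z ^ n)%C (z * CPS (shift a) z)%C) as K.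
  simpl in K. rewrite Cmult_1_r in K. apply K.
  eapply csum_ext; [|apply (csum_scal z); apply CPS_sum; [apply disk_coef_shift, H|exact hz]].
  intros n. unfold shift. simpl. ring.
Qed.

(** By induction on n, from the recursion T' = w T + (n + 1) z^n (w - z)^2 for
    consecutive remainders; the factor r on the left avoids the exponent n - 1. *)
Lemma pow_taylor (z w : C) (r : R) (n : nat) : 0 <= r -> Cmod z <= r -> Cmod w <= r ->
  r * Cmod (w ^ S n - z ^ S n - RtoC (INR (S n)) * z ^ n * (w - z))%C
    <= INR (S n) * INR (S n) * r ^ n * (Cmod (w - z) * Cmod (w - z)).
Proof.
  intros hr hz hw. set (h := Cmod (w - z)). assert (h0 : 0 <= h) by apply Cmod_ge_0.
  induction n.
  - simpl. replace (w * 1 - z * 1 - 1 * 1 * (w - z))%C with (RtoC 0) by ring.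
    rewrite Cmod_0. nra.
  - set (T := (w ^ S n - z ^ S n - RtoC (INR (S n)) * z ^ n * (w - z))%C) in *.
    replace (w ^ S (S n) - z ^ S (S n) - RtoC (INR (S (S n))) * z ^ S n * (w - z))%C
      with (w * T + RtoC (INR (S n)) * z ^ n * ((w - z) * (w - z)))%C.
    2:{ unfold T. rewrite (S_INR (S n)), RtoC_plus. simpl Cpow. ring. }
    eapply Rle_trans; [apply Rmult_le_compat_l; [exact hr|apply Cmod_triangle]|].
    rewrite !Cmod_mult, Cmod_pow, Cmod_R, Rabs_pos_eq by apply pos_INR. fold h.
    assert (zn : Cmod z ^ n <= r ^ n) by (apply pow_incr; split; [apply Cmod_ge_0|exact hz]).
    assert (rn : 0 <= r ^ n) by (apply pow_le; exact hr).
    set (N := INR (S n)) in *. assert (hN : 0 <= N) by apply pos_INR.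
    rewrite (S_INR (S n)). fold N. simpl pow.
    assert (A1 : r * (Cmod w * Cmod T) <= r * (N * N * r ^ n * (h * h))).
    { apply Rmult_le_compat_l; [exact hr|].
      eapply Rle_trans; [|exact IHn]. apply Rmult_le_compat_r; [apply Cmod_ge_0|exact hw]. }
    assert (A2 : r * (N * Cmod z ^ n * (h * h)) <= r * (N * r ^ n * (h * h))).
    { apply Rmult_le_compat_l; [exact hr|]. apply Rmult_le_compat_r; [nra|].
      apply Rmult_le_compat_l; assumption. }
    assert (A3 : 0 <= r * r ^ n * (h * h)) by (repeat apply Rmult_le_pos; assumption).
    nra.
Qed.

(** Summed against the coefficients, the quadratic remainders of the powers give
    a remainder O(|w - z|^2), because sum (n + 1)^2 |a_(n+1)| r^n converges. *)
Lemma cder_CPS (a : nat -> C) (z : C) : disk_coef a -> in_disk z ->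
  cder (CPS a) z (CPS (deriv_coef a) z).
Proof.
  intros H hz. unfold in_disk in hz. pose proof (Cmod_ge_0 z) as z0.
  set (r := (1 + Cmod z) / 2). assert (hr : 0 < r < 1) by (unfold r; lra).
  assert (hzr : Cmod z < r) by (unfold r; lra).
  set (b := fun n => Cmod (shift a n) * (INR (S n) * INR (S n) * r ^ n)).
  assert (exb : ex_series b).
  { apply (ex_series_ext (V := R_NormedModule)
      (fun n => Cmod (deriv_coef (fun n => RtoC (INR n) * a n)%C n) * r ^ n)).
    - intros n. unfold b, deriv_coef, shift. rewrite !Cmod_mult, !Cmod_R, !Rabs_pos_eq by apply pos_INR.
      match goal with |- @eq _ ?x ?y => change (@eq R x y) end; ring.
    - apply disk_coef_series; [|lra]. apply disk_coef_deriv, disk_coef_of_shift.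
      apply disk_coef_deriv, H. }
  destruct exb as [B HB].
  apply cder_iff_eps. intros e he.
  assert (B0 : 0 <= B).
  { apply (is_series_nonneg b); auto.
    intros n. unfold b. repeat apply Rmult_le_pos; try apply pos_INR; try apply Cmod_ge_0.
    apply pow_le; lra. }
  exists (Rmin (r - Cmod z) (e * r / (B + 1))). split.
  { apply Rmin_pos; [lra|]. apply Rdiv_lt_0_compat; nra. }
  intros w Hw.
  assert (hw : Cmod w <= r).
  { replace w with ((w - z) + z)%C by ring. eapply Rle_trans; [apply Cmod_triangle|].
    pose proof (Rlt_le_trans _ _ _ Hw (Rmin_l _ _)). lra. }
  assert (hw' : Cmod (w - z) * (B + 1) <= e * r).
  { pose proof (Rlt_le_trans _ _ _ Hw (Rmin_r _ _)) as L.
    apply Rmult_le_reg_r with (/ (B + 1)); [apply Rinv_0_lt_compat; lra|].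
    rewrite Rmult_assoc, Rinv_r by lra. unfold Rdiv in L. lra. }
  set (h := Cmod (w - z)) in *. assert (h0 : 0 <= h) by apply Cmod_ge_0.
  assert (S1 : csum (fun n => shift a n * (w ^ S n - z ^ S n - RtoC (INR (S n)) * z ^ n * (w - z)))%C
    (CPS a w - CPS a z - CPS (deriv_coef a) z * (w - z))%C).
  { pose proof (CPS_sum (shift a) z (disk_coef_shift _ H) hz) as s1.
    pose proof (CPS_sum (shift a) w (disk_coef_shift _ H) ltac:(unfold in_disk; lra)) as s2.
    pose proof (CPS_sum (deriv_coef a) z (disk_coef_deriv _ H) hz) as s3.
    rewrite (CPS_decr a w), (CPS_decr a z) by (auto; unfold in_disk; lra).
    replace (a 0%nat + w * CPS (shift a) w - (a 0%nat + z * CPS (shift a) z)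
      - CPS (deriv_coef a) z * (w - z))%C
      with ((w * CPS (shift a) w + (- z) * CPS (shift a) z)
        + (- (w - z)) * CPS (deriv_coef a) z)%C by ring.
    eapply csum_ext; [|apply csum_plus; [apply csum_plus; apply csum_scal; [exact s2|exact s1]|
      apply csum_scal; exact s3]].
    intros n. unfold shift, deriv_coef. simpl Cpow. ring. }
  assert (S2 : Cmod (CPS a w - CPS a z - CPS (deriv_coef a) z * (w - z)) <= / r * (h * h) * B).
  { apply (csum_bound _ _ (fun n => / r * (h * h) * b n) _ S1).
    - intros n. rewrite Cmod_mult.
      pose proof (pow_taylor z w r n ltac:(lra) ltac:(lra) hw) as P. fold h in P. unfold b.
      replace (/ r * (h * h) * (Cmod (shift a n) * (INR (S n) * INR (S n) * r ^ n)))
        with (Cmod (shift a n) * (/ r * (INR (S n) * INR (S n) * r ^ n * (h * h)))) by ring.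
      apply Rmult_le_compat_l; [apply Cmod_ge_0|].
      apply Rmult_le_reg_l with r; [lra|]. rewrite <- Rmult_assoc, Rinv_r by lra. lra.
    - apply (is_series_scal (V := R_NormedModule)). exact HB. }
  eapply Rle_trans; [exact S2|].
  apply Rmult_le_reg_l with r; [lra|].
  replace (r * (/ r * (h * h) * B)) with (h * (h * B)) by (field; lra).
  replace (r * (e * h)) with (h * (e * r)) by ring.
  apply Rmult_le_compat_l; [exact h0|]. lra.
Qed.

(** * The mean value property on circles *)

Lemma continuity_2d_ccont (g : C -> C) (p q : R -> R -> R) (x y : R) :
  ccont g (p x y, q x y) -> continuity_2d_pt p x y -> continuity_2d_pt q x y ->
  continuity_2d_pt (fun u v => Re (g (p u v, q u v))) x y /\
  continuity_2d_pt (fun u v => Im (g (p u v, q u v))) x y.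
Proof.
  intros Hg Hp Hq.
  assert (K : forall e : posreal, locally_2d (fun u v =>
    Cmod (g (p u v, q u v) - g (p x y, q x y)) < e) x y).
  { intros e. destruct (Hg e (cond_pos e)) as [d [dp Hd]].
    destruct (Hp (mkposreal (d/2) ltac:(lra))) as [d1 H1].
    destruct (Hq (mkposreal (d/2) ltac:(lra))) as [d2 H2]. simpl in H1, H2.
    exists (mkposreal _ (Rmin_stable_in_posreal d1 d2)). simpl. intros u v hu hv.
    pose proof (Rmin_l d1 d2). pose proof (Rmin_r d1 d2).
    specialize (H1 u v ltac:(lra) ltac:(lra)). specialize (H2 u v ltac:(lra) ltac:(lra)).
    apply Hd. eapply Rle_lt_trans; [apply (Cmod_le_abs (Re _) (Im _))|]. simpl.
    change (Rabs (p u v - p x y) + Rabs (q u v - q x y) < d). lra. }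
  split; intros e; destruct (K e) as [d Hd]; exists d; intros u v hu hv;
    specialize (Hd u v hu hv); (eapply Rle_lt_trans; [|exact Hd]).
  - apply (abs_Re (g (p u v, q u v) - g (p x y, q x y))%C).
  - apply (abs_Im (g (p u v, q u v) - g (p x y, q x y))%C).
Qed.

Lemma continuity_2d_slice (f : R -> R -> R) (x y : R) :
  continuity_2d_pt f x y -> continuous (fun v => f x v) y.
Proof.
  intros H. apply (filterlim_locally (U := R_UniformSpace)). intros e.
  destruct (H e) as [d Hd]. exists d. intros v hv. apply Hd; [|exact hv].
  rewrite Rminus_diag, Rabs_R0. apply cond_pos.
Qed.

Lemma Cminus_0_r (z : C) : (z - 0)%C = z.
Proof. ring. Qed.

Section MeanValue.
Variables (h h' : C -> C).
Hypothesis Hd : forall z, 0 < Cmod z < 1 -> cder h z (h' z).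
Hypothesis Hc : forall z, 0 < Cmod z < 1 -> ccont h' z.

Let px (rho t : R) := rho * cos t.
Let py (rho t : R) := rho * sin t.

Lemma Cmod_polar (rho t : R) : 0 <= rho -> Cmod (rho * cos t, rho * sin t) = rho.
Proof.
  intros H. unfold Cmod; simpl. replace (_ + _) with (rho * rho * (Rsqr (sin t) + Rsqr (cos t))).
  - rewrite sin2_cos2, Rmult_1_r. apply sqrt_square, H.
  - unfold Rsqr; ring.
Qed.

Lemma polar_cont (rho t : R) :
  continuity_2d_pt px rho t /\ continuity_2d_pt py rho t.
Proof.
  split; apply continuity_2d_pt_mult; try apply continuity_2d_pt_id1;
    apply (continuity_1d_2d_pt_comp _ (fun _ v => v)); try apply continuity_2d_pt_id2.
  - apply derivable_continuous_pt, derivable_pt_cos.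
  - apply derivable_continuous_pt, derivable_pt_sin.
Qed.

Let dr (rho t : R) := Re (h' (px rho t, py rho t) * (cos t, sin t))%C.

Lemma radial_derive (rho t : R) : 0 < rho < 1 ->
  is_derive (fun u => Re (h (px u t, py u t))) rho (dr rho t).
Proof.
  intros hr. apply (deriv_along h (fun u => px u t) (fun u => py u t)).
  - apply Hd. unfold px, py. rewrite Cmod_polar; lra.
  - unfold px. auto_derive; auto; ring.
  - unfold py. auto_derive; auto; ring.
Qed.

(** By the Cauchy-Riemann equations the radial derivative of Re h is also the
    angular derivative of Im h / rho. *)
Lemma angular_derive (rho t : R) : 0 < rho < 1 ->
  is_derive (fun v => / rho * Im (h (px rho v, py rho v))) t (dr rho t).
Proof.
  intros hr. unfold dr.
  replace (Re (h' (px rho t, py rho t) * (cos t, sin t))%C)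
    with (/ rho * Im (h' (px rho t, py rho t) * ((- (rho * sin t))%R, (rho * cos t)%R))%C).
  - apply (is_derive_scal (fun v => Im (h (px rho v, py rho v)))).
    apply (deriv_along h (fun v => px rho v) (fun v => py rho v)).
    + apply Hd. unfold px, py. rewrite Cmod_polar; lra.
    + unfold px. auto_derive; auto; ring.
    + unfold py. auto_derive; auto; ring.
  - simpl. field. lra.
Qed.

Lemma radial_continuity (rho t : R) : 0 < rho < 1 -> continuity_2d_pt dr rho t.
Proof.
  intros hr. destruct (polar_cont rho t) as [c1 c2].
  destruct (continuity_2d_ccont h' px py rho t) as [k1 k2]; auto.
  { apply Hc. unfold px, py. rewrite Cmod_polar; lra. }
  apply (continuity_2d_pt_ext (fun u v =>
    Re (h' (px u v, py u v)) * cos v - Im (h' (px u v, py u v)) * sin v)).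
  { intros; reflexivity. }
  apply continuity_2d_pt_minus; apply continuity_2d_pt_mult; auto;
    apply (continuity_1d_2d_pt_comp _ (fun _ v => v)); try apply continuity_2d_pt_id2.
  - apply derivable_continuous_pt, derivable_pt_cos.
  - apply derivable_continuous_pt, derivable_pt_sin.
Qed.

Let u (rho : R) : R := RInt (fun t => Re (h (px rho t, py rho t))) 0 (2 * PI).

Lemma h_slice_continuous (rho t : R) : 0 < rho < 1 ->
  continuous (fun t => Re (h (px rho t, py rho t))) t.
Proof.
  intros hr. destruct (polar_cont rho t) as [c1 c2].
  apply (continuity_2d_slice (fun rho t => Re (h (px rho t, py rho t)))).
  apply continuity_2d_ccont; auto. apply cder_ccont with (h' (px rho t, py rho t)).
  apply Hd. unfold px, py. rewrite Cmod_polar; lra.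
Qed.

(** Differentiating under the integral sign leaves the integral of an angular
    derivative over a full turn. *)
Lemma circle_integral_derive (rho : R) : 0 < rho < 1 -> is_derive u rho 0.
Proof.
  intros hr.
  assert (loc : locally rho (fun y => 0 < y < 1)).
  { exists (mkposreal (Rmin rho (1 - rho)) ltac:(apply Rmin_pos; lra)).
    intros y Hy. change (Rabs (y - rho) < Rmin rho (1 - rho)) in Hy.
    pose proof (Rmin_l rho (1 - rho)). pose proof (Rmin_r rho (1 - rho)).
    apply Rabs_def2 in Hy. lra. }
  assert (D : forall y t, 0 < y < 1 -> Derive (fun z => Re (h (px z t, py z t))) y = dr y t).
  { intros y t hy. apply is_derive_unique, radial_derive, hy. }
  replace 0 with (RInt (fun t => Derive (fun z => Re (h (px z t, py z t))) rho) 0 (2 * PI)).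
  - apply (is_derive_RInt_param (fun rho t => Re (h (px rho t, py rho t)))).
    + revert loc. apply filter_imp. intros y hy t _. eexists. apply radial_derive, hy.
    + intros t _. apply continuity_2d_pt_ext_loc with dr; [|apply radial_continuity, hr].
      destruct loc as [d Hloc]. exists d. intros y v hy _. symmetry. apply D, Hloc, hy.
    + revert loc. apply filter_imp. intros y hy. apply (ex_RInt_continuous (V := R_CompleteNormedModule)).
      intros t _. apply h_slice_continuous, hy.
  - apply is_RInt_unique.
    apply (is_RInt_ext (dr rho)).
    { intros t _. symmetry. apply D, hr. }
    replace 0 with (minus (/ rho * Im (h (px rho (2 * PI), py rho (2 * PI))))
                          (/ rho * Im (h (px rho 0, py rho 0)))) at 2.
    + apply (is_RInt_derive (V := R_CompleteNormedModule) (fun v => / rho * Im (h (px rho v, py rho v)))).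
      * intros t _. apply angular_derive, hr.
      * intros t _. apply continuity_2d_slice, radial_continuity, hr.
    + unfold px, py. rewrite cos_2PI, sin_2PI, cos_0, sin_0. unfold minus, plus, opp; simpl. ring.
Qed.

(** The mean of Re h is the same on all circles about the origin and tends to
    Re (h 0) as the circles shrink. Only continuity is asked of h at the origin,
    so that h may have a filled-in singularity there. *)
Lemma Re_center_nonneg (r : R) : 0 < r < 1 -> ccont h (RtoC 0) ->
  (forall z, Cmod z = r -> 0 <= Re (h z)) -> 0 <= Re (h (RtoC 0)).
Proof.
  intros hr H0 Hpos.
  assert (P := PI_RGT_0).
  assert (ur : 0 <= u r).
  { apply RInt_ge_0; [lra| |].
    - apply (ex_RInt_continuous (V := R_CompleteNormedModule)). intros t _. apply h_slice_continuous, hr.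
    - intros t _. apply Hpos. unfold px, py. apply Cmod_polar. lra. }
  apply le_epsilon. intros e he.
  destruct (H0 e he) as [d [dp H]].
  set (rho := Rmin d r / 2).
  assert (hrho : 0 < rho /\ rho < d /\ rho < r).
  { pose proof (Rmin_l d r). pose proof (Rmin_r d r).
    assert (0 < Rmin d r) by (apply Rmin_pos; lra). unfold rho; lra. }
  assert (E : u rho = u r).
  { destruct (MVT_gen u rho r (fun _ => 0)) as [c [_ E]].
    - rewrite Rmin_left, Rmax_right by lra. intros x hx. apply circle_integral_derive. lra.
    - rewrite Rmin_left, Rmax_right by lra. intros x hx.
      apply derivable_continuous_pt. eexists. apply is_derive_Reals.
      apply circle_integral_derive. lra.
    - lra. }
  assert (L : u rho <= (2 * PI - 0) * (Re (h (RtoC 0)) + e)).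
  { apply Rle_trans with (RInt (fun _ => Re (h (RtoC 0)) + e) 0 (2 * PI)).
    - apply RInt_le; [lra| | |].
      + apply (ex_RInt_continuous (V := R_CompleteNormedModule)). intros t _.
        apply h_slice_continuous. lra.
      + apply ex_RInt_const.
      + intros t _. assert (K : Cmod ((px rho t, py rho t) - 0) < d).
        { rewrite Cminus_0_r. unfold px, py. rewrite Cmod_polar; lra. }
        specialize (H _ K). pose proof (abs_Re (h (px rho t, py rho t) - h (RtoC 0))%C) as A.
        pose proof (Rle_abs (Re (h (px rho t, py rho t) - h (RtoC 0))%C)) as A'.
        change (Re (h (px rho t, py rho t) - h (RtoC 0))%C)
          with (Re (h (px rho t, py rho t)) - Re (h (RtoC 0))) in *. lra.
    - rewrite RInt_const. right. reflexivity. }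
  nra.
Qed.
End MeanValue.

(** * Contractive Toeplitz matrices and the Hankel functional *)

Definition nsq (z : C) : R := Re z * Re z + Im z * Im z.

Lemma nsq_Cmod (z : C) : nsq z = Cmod z * Cmod z.
Proof. rewrite <- Cmod_sqr_Re. destruct z; unfold nsq; simpl; ring. Qed.

Lemma nsq_ge_0 (z : C) : 0 <= nsq z.
Proof. unfold nsq; nra. Qed.

Lemma nsq_mult (z w : C) : nsq (z * w)%C = nsq z * nsq w.
Proof. destruct z, w; unfold nsq; simpl; ring. Qed.

Lemma nsq_RtoC (r : R) : nsq (RtoC r) = r * r.
Proof. unfold nsq; simpl; ring. Qed.

Lemma nsq_conj (z : C) : nsq (Cconj z) = nsq z.
Proof. destruct z; unfold nsq; simpl; ring. Qed.

Lemma Cmult_conj_nsq (z : C) : (z * Cconj z)%C = RtoC (nsq z).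
Proof. destruct z; unfold nsq, RtoC, Cmult, Cconj; simpl; f_equal; ring. Qed.

Lemma nsq_eq_0 (z : C) : nsq z = 0 -> z = RtoC 0.
Proof. intros E. rewrite nsq_Cmod in E. apply Cmod_eq_0, Rsqr_0_uniq, E. Qed.

Lemma nsq_shear (a b t : C) (k : R) :
  nsq (b * RtoC k + a * t)
  = nsq (Cconj a * b * RtoC k + t) + nsq b * k * ((1 - nsq a) * k) - (1 - nsq a) * nsq t.
Proof. destruct a, b, t. unfold nsq. simpl. ring. Qed.

(** The Toeplitz matrix is that of multiplication by
    c1 z + c2 z^2 + c3 z^3 + ... on quadratic polynomials, modulo z^4. *)
Definition toeplitz_contraction (c1 c2 c3 : C) : Prop :=
  forall u0 u1 u2 : C,
    nsq (c1 * u0) + nsq (c2 * u0 + c1 * u1) + nsq (c3 * u0 + c2 * u1 + c1 * u2)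
      <= nsq u0 + nsq u1 + nsq u2.

Section Schur.
Variables c1 c2 c3 : C.
Hypothesis H : toeplitz_contraction c1 c2 c3.

Lemma toeplitz_column : nsq c1 + nsq c2 + nsq c3 <= 1.
Proof.
  specialize (H (RtoC 1) (RtoC 0) (RtoC 0)).
  rewrite !Cmult_1_r, !Cmult_0_r, !Cplus_0_r, !nsq_RtoC in H. lra.
Qed.

Let d := 1 - nsq c1.
Let k := / d.
(** The deviation of c3 from the value that c1 and c2 alone would force if
    |c2| were maximal: the numerator of the third Schur parameter. *)
Definition schur_rest : C := (c3 + Cconj c1 * (c2 * c2) * RtoC k)%C.

(** Elimination of u2. *)
Lemma toeplitz_2 (u0 u1 : C) : 0 < d ->
  nsq (c1 * u0) + nsq (c2 * u0 + c1 * u1) + nsq (c3 * u0 + c2 * u1) * k <= nsq u0 + nsq u1.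
Proof.
  intros hd. assert (hk : d * k = 1) by (unfold k; field; lra).
  set (al := (c3 * u0 + c2 * u1)%C).
  (* the last entry that makes the inequality strongest *)
  pose proof (H u0 u1 (Cconj c1 * (al * RtoC k))%C) as L. fold al in L.
  assert (E : (al + c1 * (Cconj c1 * (al * RtoC k)))%C = (al * RtoC k)%C).
  { transitivity (al * (1 + (c1 * Cconj c1) * RtoC k))%C; [ring|].
    rewrite Cmult_conj_nsq, <- RtoC_mult, <- RtoC_plus. do 2 f_equal.
    unfold d in hk. lra. }
  rewrite E, !nsq_mult, nsq_conj, nsq_RtoC in L. rewrite nsq_mult.
  replace (nsq al * k) with (nsq al * (k * k) - nsq c1 * (nsq al * (k * k))); [lra|].
  transitivity (nsq al * k * (d * k)); [unfold d; ring|]. rewrite hk; ring.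
Qed.

(** The choice u0 = 1, u1 = conj(c1) c2 / d + t completes the square in u1. *)
Lemma schur_rest_translate (t : C) : 0 < d ->
  nsq (schur_rest + c2 * t) <= d * d - nsq c2 + d * d * nsq t.
Proof.
  intros hd. assert (hk : d * k = 1) by (unfold k; field; lra).
  pose proof (toeplitz_2 (RtoC 1) (Cconj c1 * c2 * RtoC k + t)%C hd) as L.
  replace (c3 * 1 + c2 * (Cconj c1 * c2 * RtoC k + t))%C with (schur_rest + c2 * t)%C in L
    by (unfold schur_rest; ring).
  assert (E : nsq (c2 * 1 + c1 * (Cconj c1 * c2 * RtoC k + t))
    = nsq (Cconj c1 * c2 * RtoC k + t) + nsq c2 * k - d * nsq t).
  { replace (c2 * 1 + c1 * (Cconj c1 * c2 * RtoC k + t))%C with (c2 * RtoC k + c1 * t)%C.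
    - transitivity (nsq (Cconj c1 * c2 * RtoC k + t) + nsq c2 * k * (d * k) - d * nsq t).
      + apply nsq_shear.
      + rewrite hk. ring.
    - transitivity (c2 * (1 + (c1 * Cconj c1) * RtoC k) + c1 * t)%C; [|ring].
      rewrite Cmult_conj_nsq, <- RtoC_mult, <- RtoC_plus. do 3 f_equal.
      unfold d in hk. lra. }
  rewrite E, Cmult_1_r, nsq_RtoC in L.
  assert (L' : (nsq (schur_rest + c2 * t) + nsq c2) * k <= d + d * nsq t) by (unfold d in *; lra).
  apply (Rmult_le_compat_l d) in L'; [|lra].
  replace (d * ((nsq (schur_rest + c2 * t) + nsq c2) * k))
    with ((d * k) * (nsq (schur_rest + c2 * t) + nsq c2)) in L' by ring.
  rewrite hk in L'. lra.
Qed.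

(** The second bound comes from the translation t = conj(c2) rest / e with
    e = d^2 - |c2|^2, which maximises the gain; t = 0 settles e = 0. Together
    they are the Schur inequalities for the first three coefficients. *)
Lemma schur_bounds : 0 < d -> nsq c2 <= d * d /\ Cmod schur_rest * d <= d * d - nsq c2.
Proof.
  intros hd. set (e := d * d - nsq c2).
  pose proof (schur_rest_translate (RtoC 0) hd) as L0.
  rewrite Cmult_0_r, Cplus_0_r, nsq_RtoC in L0.
  pose proof (nsq_ge_0 schur_rest) as b0. pose proof (nsq_ge_0 c2) as c20.
  split; [lra|].
  assert (K : nsq schur_rest * (d * d) <= e * e).
  { destruct (Rle_lt_dec e 0) as [he|he].
    - assert (e = 0) by (unfold e in *; lra).
      assert (nsq schur_rest = 0) by (unfold e in *; lra). rewrite H0, H1. lra.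
    - assert (hi : e * / e = 1) by (field; lra).
      pose proof (schur_rest_translate (Cconj c2 * schur_rest * RtoC (/ e))%C hd) as L.
      assert (E : (schur_rest + c2 * (Cconj c2 * schur_rest * RtoC (/ e)))%C
        = (schur_rest * RtoC (d * d * / e))%C).
      { transitivity (schur_rest * (1 + (c2 * Cconj c2) * RtoC (/ e)))%C; [ring|].
        rewrite Cmult_conj_nsq, <- RtoC_mult, <- RtoC_plus. do 2 f_equal.
        rewrite <- hi. unfold e. ring. }
      rewrite E, !nsq_mult, nsq_conj, !nsq_RtoC in L. fold e in L.
      assert (p : 0 < / e) by (apply Rinv_0_lt_compat, he).
      set (i := / e) in *. set (b := nsq schur_rest) in *.
      apply Rmult_le_reg_r with (i * (i * e)); [rewrite (Rmult_comm i e), hi; lra|].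
      replace (e * e * (i * (i * e))) with (e * (e * i) * (e * i)) by ring. rewrite hi.
      replace (b * (d * d) * (i * (i * e)))
        with (b * (d * d * i * (d * d * i)) - d * d * (nsq c2 * b * (i * i)))
        by (unfold e; ring). lra. }
  rewrite nsq_Cmod in K.
  apply Rsqr_incr_0_var; [unfold Rsqr; fold e; lra|unfold e in *; lra].
Qed.
End Schur.

(** Here x = |c1| and |c2| = (1 - x^2) y. *)
Lemma hankel_real_bound (x y : R) : 0 <= x <= 1 -> 0 <= y <= 1 ->
  x * (1 - x * x) * (1 - y * y) / 3 + (1 - x * x) * (y * y) * (3 + x * x) / 12
    + x * x * (1 - x * x) * y / 6 + x * x * (x * x) / 18 <= 1 / 4.
Proof.
  intros hx hy.
  set (D := 1 - x * x). assert (hD : 0 <= D) by (unfold D; nra).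
  (* after division by D the left side increases in y: its coefficient of y^2 is
     (1 - x)(3 - x) / 12 *)
  assert (E : x * (1 - y * y) / 3 + (y * y) * (3 + x * x) / 12 + x * x * y / 6
    <= (1 + x * x) / 4).
  { assert (0 <= (1 - x) * (3 - x) * (1 - y * y)) by (repeat apply Rmult_le_pos; nra).
    assert (0 <= x * x * (1 - y)) by (repeat apply Rmult_le_pos; nra). nra. }
  assert (F : D * (x * (1 - y * y) / 3 + (y * y) * (3 + x * x) / 12 + x * x * y / 6)
    <= D * ((1 + x * x) / 4)) by (apply Rmult_le_compat_l; assumption).
  assert (D * ((1 + x * x) / 4) = 1 / 4 - x * x * (x * x) / 4) by (unfold D; field).
  assert (0 <= x * x * (x * x)) by nra. lra.
Qed.

(** (a2 a4 - a3^2) / s^2 when z f' / f = q_s(w) and w has the Taylor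
    coefficients c1, c2, c3. *)
Definition hankel_schwarz (s : R) (c1 c2 c3 : C) : C :=
  (RtoC (/ 3) * (c1 * c3) + RtoC (- / 4) * (c2 * c2)
   + RtoC ((s + 1) / 12) * (c1 * c1 * c2)
   + RtoC ((1 - s) * (13 * s + 7) / 144) * (c1 * c1 * (c1 * c1)))%C.

(** Writing c3 = rest - conj(c1) c2^2 / d splits the functional into four terms
    that can be estimated separately without loss at c1 = 0, |c2| = 1. *)
Lemma hankel_schwarz_bound (s : R) (c1 c2 c3 : C) : 0 < s <= 1 ->
  toeplitz_contraction c1 c2 c3 -> Cmod (hankel_schwarz s c1 c2 c3) <= 1 / 4.
Proof.
  intros hs H. pose proof (toeplitz_column _ _ _ H) as col.
  pose proof (nsq_ge_0 c1). pose proof (nsq_ge_0 c2). pose proof (nsq_ge_0 c3).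
  set (x := Cmod c1). assert (hx0 : 0 <= x) by apply Cmod_ge_0.
  assert (hx2 : nsq c1 = x * x) by apply nsq_Cmod.
  assert (hK : 0 <= (1 - s) * (13 * s + 7) / 144 <= 1 / 18).
  { split; [|pose proof (Rle_0_sqr (s - 3 / 13)) as sq; unfold Rsqr in sq; nra]. apply Rdiv_le_0_compat; [|lra]. apply Rmult_le_pos; lra. }
  set (K := (1 - s) * (13 * s + 7) / 144) in *.
  assert (hx1 : x <= 1) by nra.
  destruct (Req_dec (nsq c1) 1) as [E1|N1].
  - assert (z2 : c2 = RtoC 0) by (apply nsq_eq_0; lra).
    assert (z3 : c3 = RtoC 0) by (apply nsq_eq_0; lra).
    unfold hankel_schwarz. fold K. rewrite z2, z3, !Cmult_0_r, !Cplus_0_l.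
    rewrite !Cmod_mult, Cmod_R, Rabs_pos_eq by lra. fold x. rewrite <- hx2, E1. lra.
  - assert (hd : 0 < 1 - nsq c1) by lra.
    destruct (schur_bounds _ _ _ H hd) as [S1 S2].
    set (b := schur_rest c1 c2 c3) in *. set (D := 1 - nsq c1) in *.
    set (y := Cmod c2 * / D).
    assert (hi : 0 < / D) by (apply Rinv_0_lt_compat, hd).
    assert (hy0 : 0 <= y) by (apply Rmult_le_pos; [apply Cmod_ge_0|lra]).
    assert (hc2 : Cmod c2 = D * y) by (unfold y; field; lra).
    rewrite nsq_Cmod, hc2 in S1, S2.
    assert (hy1 : y <= 1).
    { destruct (Rle_lt_dec y 1) as [l|l]; [exact l|exfalso].
      assert (D * D * 1 < D * D * (y * y)) by (apply Rmult_lt_compat_l; nra). lra. }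
    assert (hb : Cmod b <= D * (1 - y * y)).
    { apply Rmult_le_reg_r with D; [lra|]. lra. }
    assert (E : hankel_schwarz s c1 c2 c3 = (RtoC (/ 3) * (c1 * b)
      + (- (RtoC (nsq c1 * / D / 3 + / 4)) * (c2 * c2)
      + (RtoC ((s + 1) / 12) * (c1 * c1 * c2) + RtoC K * (c1 * c1 * (c1 * c1)))))%C).
    { unfold hankel_schwarz, b, schur_rest. fold K D.
      unfold Rdiv. rewrite RtoC_plus, !(RtoC_mult _ (/ 3)), (RtoC_mult (nsq c1)), <- (Cmult_conj_nsq c1), RtoC_opp. ring. }
    rewrite E.
    eapply Rle_trans; [apply Cmod_triangle|].
    eapply Rle_trans; [apply Rplus_le_compat_l, Cmod_triangle|].
    eapply Rle_trans; [apply Rplus_le_compat_l, Rplus_le_compat_l, Cmod_triangle|].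
    rewrite !Cmod_mult, Cmod_opp, !Cmod_R, hc2. fold x.
    assert (p1 : 0 <= nsq c1 * / D / 3 + / 4).
    { assert (0 <= nsq c1 * / D) by (apply Rmult_le_pos; lra). lra. }
    rewrite !Rabs_pos_eq by lra.
    pose proof (hankel_real_bound x y ltac:(lra) ltac:(lra)) as B.
    assert (t1 : / 3 * (x * Cmod b) <= / 3 * (x * (D * (1 - y * y)))).
    { apply Rmult_le_compat_l; [lra|]. apply Rmult_le_compat_l; lra. }
    assert (t2 : (nsq c1 * / D / 3 + / 4) * (D * y * (D * y)) = D * (y * y) * (3 + x * x) / 12).
    { transitivity (y * y * D * (nsq c1 * (D * / D) / 3 + D / 4)); [field; lra|].
      rewrite Rinv_r by lra. unfold D at 2. rewrite hx2. field. }
    assert (t3 : (s + 1) / 12 * (x * x * (D * y)) <= 1 / 6 * (x * x * (D * y))).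
    { apply Rmult_le_compat_r; [|lra]. apply Rmult_le_pos; [nra|]. apply Rmult_le_pos; lra. }
    assert (t4 : K * (x * x * (x * x)) <= 1 / 18 * (x * x * (x * x))).
    { apply Rmult_le_compat_r; [nra|lra]. }
    assert (hD : D = 1 - x * x) by (unfold D; rewrite hx2; ring).
    rewrite t2. rewrite <- hD in B. lra.
Qed.

(** * Taylor coefficients of Schwarz functions *)

(** g = O(z^n) at the origin. The bound holds at z = 0 as well, so that g(0) = 0
    for positive n. *)
Definition flat_at_0 (n : nat) (g : C -> C) : Prop :=
  exists M d, 0 <= M /\ 0 < d /\ forall z, Cmod z < d -> Cmod (g z) <= M * Cmod z ^ n.

(** A holomorphic substitute for |u0 + u1 z + u2 z^2|^2, of which it is the real
    part on the circle |z|^2 = rr. *)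
Definition sq_modulus_poly (u0 u1 u2 : C) (rr : R) (z : C) : C :=
  (RtoC (nsq u0 + nsq u1 * rr + nsq u2 * (rr * rr))
   + (RtoC 2 * (Cconj u0 * u1 + RtoC rr * (Cconj u1 * u2)) * z
      + RtoC 2 * (Cconj u0 * u2) * (z * z)))%C.

Lemma sq_modulus_poly_circle (u0 u1 u2 z : C) :
  Re (sq_modulus_poly u0 u1 u2 (nsq z) z) = nsq (u0 + u1 * z + u2 * (z * z))%C.
Proof. destruct u0, u1, u2, z. unfold sq_modulus_poly, nsq. simpl. ring. Qed.

Lemma C1_poly2 (a b c z : C) :
  cder (fun z => a + (b * z + c * (z * z)))%C z (b + c * (z + z))%C.
Proof.
  eapply cder_eq.
  - apply cder_plus; [apply cder_const|]. apply cder_plus;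
      (apply cder_mult; [apply cder_const|]); [apply cder_id|apply cder_mult; apply cder_id].
  - simpl. ring.
Qed.

Lemma ccont_of_linear_bound (g : C -> C) (M d : R) : 0 < d -> 0 <= M ->
  (forall z, Cmod z < d -> Cmod (g z) <= M * Cmod z) -> ccont g (RtoC 0).
Proof.
  intros hd hM H e he.
  assert (g0 : g (RtoC 0) = RtoC 0).
  { apply Cmod_eq_0. pose proof (H (RtoC 0)) as K. rewrite Cmod_0 in K.
    specialize (K hd). pose proof (Cmod_ge_0 (g (RtoC 0))). lra. }
  exists (Rmin d (e / (M + 1))). split.
  { apply Rmin_pos; [exact hd|]. apply Rdiv_lt_0_compat; lra. }
  intros z hz. rewrite g0, !Cminus_0_r in *.
  specialize (H z (Rlt_le_trans _ _ _ hz (Rmin_l _ _))).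
  pose proof (Rlt_le_trans _ _ _ hz (Rmin_r _ _)) as L.
  assert (Cmod z * (M + 1) < e).
  { apply Rmult_lt_reg_r with (/ (M + 1)); [apply Rinv_0_lt_compat; lra|].
    rewrite Rmult_assoc, Rinv_r by lra. unfold Rdiv in L. lra. }
  pose proof (Cmod_ge_0 z). nra.
Qed.

Section Schwarz.
Variables (w w' : C -> C) (c1 c2 c3 : C).
Hypothesis wd : forall z, in_disk z -> cder w z (w' z).
Hypothesis wc : forall z, in_disk z -> ccont w' z.
Hypothesis wb : forall z, in_disk z -> in_disk (w z).
Hypothesis wj : flat_at_0 4 (fun z => w z - (c1 * z + c2 * (z * z) + c3 * (z * z * z)))%C.

Variables (u0 u1 u2 : C).
Let s1 := (c1 * u0)%C.
Let s2 := (c2 * u0 + c1 * u1)%C.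
Let s3 := (c3 * u0 + c2 * u1 + c1 * u2)%C.
Let u (z : C) := (u0 + (u1 * z + u2 * (z * z)))%C.
Let sq (z : C) := (s1 + (s2 * z + s3 * (z * z)))%C.
(** Remainder of w u after its Taylor polynomial of degree three. *)
Let rem (z : C) := (w z * u z + (- (1)) * (z * sq z))%C.
(** The holomorphic function that equals conj z on the circle |z|^2 = rr. *)
Let refl (rr : R) (z : C) := (RtoC rr * / z)%C.
(** Equal to the conjugate of the Taylor polynomial z (sq z) on that circle. *)
Let L (rr : R) (z : C) :=
  (refl rr z * (Cconj s1 + (Cconj s2 * refl rr z + Cconj s3 * (refl rr z * refl rr z))))%C.
(** With S the Taylor polynomial of w u, the real part of h on the circle is
   |u|^2 - |S|^2 - 2 Re (conj S (w u - S)) = |u|^2 - |w u|^2 + |w u - S|^2 >= 0,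
   while its value at 0 is the difference of the two truncated square sums. *)
Let h (rr : R) (z : C) :=
  (sq_modulus_poly u0 u1 u2 rr z
   + ((- RtoC rr) * sq_modulus_poly s1 s2 s3 rr z + (- (2)) * (L rr z * rem z)))%C.

Lemma rem_flat : flat_at_0 4 rem.
Proof.
  destruct wj as [M [d [hM [hd H]]]].
  set (A := Cmod u0 + Cmod u1 + Cmod u2).
  exists (M * A + (Cmod (c2 * u2 + c3 * u1) + Cmod (c3 * u2))), (Rmin d 1).
  pose proof (Cmod_ge_0 u0). pose proof (Cmod_ge_0 u1). pose proof (Cmod_ge_0 u2).
  pose proof (Cmod_ge_0 (c2 * u2 + c3 * u1)). pose proof (Cmod_ge_0 (c3 * u2)).
  assert (hA : 0 <= A) by (unfold A; lra).
  split; [nra|]. split; [apply Rmin_pos; lra|]. intros z hz.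
  assert (z1 : Cmod z < 1) by (eapply Rlt_le_trans; [exact hz|apply Rmin_r]).
  specialize (H z (Rlt_le_trans _ _ _ hz (Rmin_l _ _))). cbv beta in H.
  pose proof (Cmod_ge_0 z) as z0.
  set (t := (w z - (c1 * z + c2 * (z * z) + c3 * (z * z * z)))%C) in *.
  replace (rem z) with (t * u z + (z * (z * (z * (z * (c2 * u2 + c3 * u1 + z * (c3 * u2)))))))%C
    by (unfold rem, u, sq, s1, s2, s3, t; ring).
  eapply Rle_trans; [apply Cmod_triangle|]. rewrite Rmult_plus_distr_r.
  apply Rplus_le_compat.
  - rewrite Cmod_mult. rewrite Rmult_assoc, (Rmult_comm A), <- Rmult_assoc.
    apply Rmult_le_compat; try apply Cmod_ge_0; [exact H|].
    unfold u. eapply Rle_trans; [apply Cmod_triangle|]. unfold A. rewrite Rplus_assoc.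
    apply Rplus_le_compat_l.
    eapply Rle_trans; [apply Cmod_triangle|]. rewrite !Cmod_mult.
    apply Rplus_le_compat; [nra|]. assert (Cmod z * Cmod z <= 1) by nra. nra.
  - rewrite !(Cmod_mult z). set (x := Cmod z) in *.
    assert (B : Cmod (c2 * u2 + c3 * u1 + z * (c3 * u2)) <= Cmod (c2 * u2 + c3 * u1) + Cmod (c3 * u2)).
    { eapply Rle_trans; [apply Cmod_triangle|]. apply Rplus_le_compat_l.
      rewrite (Cmod_mult z). fold x. nra. }
    replace (x * (x * (x * (x * Cmod (c2 * u2 + c3 * u1 + z * (c3 * u2))))))
      with (Cmod (c2 * u2 + c3 * u1 + z * (c3 * u2)) * x ^ 4) by ring.
    apply Rmult_le_compat_r; [apply pow_le; lra|exact B].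
Qed.

Lemma h_at_0 (rr : R) : h rr (RtoC 0)
  = RtoC (nsq u0 + nsq u1 * rr + nsq u2 * (rr * rr) - rr * (nsq s1 + nsq s2 * rr + nsq s3 * (rr * rr))).
Proof.
  assert (E : rem (RtoC 0) = RtoC 0).
  { apply Cmod_eq_0. destruct rem_flat as [M [d [_ [hd H]]]]. specialize (H (RtoC 0)).
    rewrite Cmod_0 in H. specialize (H hd). pose proof (Cmod_ge_0 (rem (RtoC 0))).
    simpl in H. lra. }
  unfold h. rewrite E. unfold sq_modulus_poly.
  rewrite RtoC_minus, (RtoC_mult rr). ring.
Qed.

(** L has a pole of order three, which rem = O(z^4) cancels. *)
Lemma h_cont_0 (rr : R) : 0 <= rr <= 1 -> ccont (h rr) (RtoC 0).
Proof.
  intros hrr. destruct rem_flat as [M [d [hM [hd H]]]].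
  apply ccont_plus; [eapply cder_ccont; apply C1_poly2|].
  apply ccont_plus; (apply ccont_mult; [apply ccont_const|]);
    [eapply cder_ccont; apply C1_poly2|].
  set (T := Cmod s1 + Cmod s2 + Cmod s3).
  assert (hT : 0 <= T).
  { pose proof (Cmod_ge_0 s1). pose proof (Cmod_ge_0 s2). pose proof (Cmod_ge_0 s3). unfold T; lra. }
  apply (ccont_of_linear_bound _ (T * M) (Rmin d 1)); [apply Rmin_pos; lra|nra|].
  intros z hz.
  assert (z1 : Cmod z < 1) by (eapply Rlt_le_trans; [exact hz|apply Rmin_r]).
  specialize (H z (Rlt_le_trans _ _ _ hz (Rmin_l _ _))).
  destruct (Ceq_dec z (RtoC 0)) as [->|n].
  { rewrite Cmod_0 in *. simpl in H. rewrite Cmod_mult.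
    assert (E : Cmod (rem (RtoC 0)) = 0) by (pose proof (Cmod_ge_0 (rem (RtoC 0))); lra).
    rewrite E. lra. }
  assert (zp : 0 < Cmod z) by (apply Cmod_gt_0; exact n).
  rewrite Cmod_mult. set (x := Cmod z) in *. set (y := / x).
  assert (xy : x * y = 1) by (unfold y; field; lra).
  assert (y1 : 1 <= y) by nra.
  assert (hrf : Cmod (refl rr z) <= y).
  { unfold refl. rewrite Cmod_mult, Cmod_R, Cmod_inv, Rabs_pos_eq by (auto; lra). fold x y. nra. }
  set (q := refl rr z) in *. pose proof (Cmod_ge_0 q) as q0.
  assert (HL : Cmod (L rr z) <= T * (y * y * y)).
  { unfold L. fold q. rewrite Cmod_mult.
    assert (B : Cmod (Cconj s1 + (Cconj s2 * q + Cconj s3 * (q * q))) <= T * (y * y)).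
    { eapply Rle_trans; [apply Cmod_triangle|].
      eapply Rle_trans; [apply Rplus_le_compat_l, Cmod_triangle|].
      rewrite !Cmod_mult, !Cmod_conj. unfold T. rewrite !Rmult_plus_distr_r, Rplus_assoc.
      assert (1 <= y * y) by nra. assert (Cmod q * Cmod q <= y * y) by nra.
      assert (Cmod q <= y * y) by nra.
      repeat apply Rplus_le_compat; [|apply Rmult_le_compat_l; [apply Cmod_ge_0|lra]..].
      rewrite <- (Rmult_1_r (Cmod s1)) at 1. apply Rmult_le_compat_l; [apply Cmod_ge_0|lra]. }
    replace (T * (y * y * y)) with (y * (T * (y * y))) by ring.
    apply Rmult_le_compat; auto. apply Cmod_ge_0. }
  apply Rle_trans with (T * (y * y * y) * (M * x ^ 4)).
  - apply Rmult_le_compat; try apply Cmod_ge_0; assumption.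
  - right. transitivity (T * M * x * ((x * y) * (x * y) * (x * y))); [ring|rewrite xy; ring].
Qed.

Lemma h_C1 (rr : R) : exists h', forall z, 0 < Cmod z < 1 -> cder (h rr) z (h' z) /\ ccont h' z.
Proof.
  eexists. intros z hz.
  assert (n : z <> RtoC 0) by (intros ->; rewrite Cmod_0 in hz; lra).
  assert (hz' : in_disk z) by (unfold in_disk; lra).
  assert (Cu : cder u z (u1 + u2 * (z + z))%C) by apply C1_poly2.
  assert (Cs : cder sq z (s2 + s3 * (z + z))%C) by apply C1_poly2.
  assert (Cr : cder (refl rr) z (RtoC rr * (- (1) / (z * z)))%C).
  { eapply cder_eq; [apply cder_mult; [apply cder_const|apply (cder_inv (fun z => z)); [apply cder_id|exact n]]|].
    simpl. ring. }
  split.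
  - unfold h. apply cder_plus; [apply C1_poly2|].
    apply cder_plus; (apply cder_mult; [apply cder_const|]); [apply C1_poly2|].
    apply cder_mult.
    + unfold L. apply cder_mult; [exact Cr|].
      apply (cder_comp (fun y => Cconj s1 + (Cconj s2 * y + Cconj s3 * (y * y)))%C (refl rr));
        [apply C1_poly2|exact Cr].
    + unfold rem. apply cder_plus; [apply cder_mult; [apply wd, hz'|exact Cu]|].
      apply cder_mult; [apply cder_const|]. apply cder_mult; [apply cder_id|exact Cs].
  - cbv beta.
    assert (c0 : ccont w z) by (eapply cder_ccont, wd, hz').
    assert (c4 : ccont w' z) by (apply wc, hz').
    assert (c5 : ccont u z) by (eapply cder_ccont, Cu).
    assert (c6 : ccont sq z) by (eapply cder_ccont, Cs).
    assert (c7 : ccont (refl rr) z) by (eapply cder_ccont, Cr).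
    assert (c8 : ccont (fun z => / (z * z))%C z).
    { apply (ccont_inv (fun z => z * z)%C); [apply ccont_mult; apply ccont_id|apply Cmult_neq_0; assumption]. }
    unfold Cdiv.
    repeat first [exact c0|exact c4|exact c5|exact c6|exact c7|exact c8|apply ccont_id|apply ccont_const|apply ccont_plus|apply ccont_mult].
Qed.

Lemma h_circle (r : R) (z : C) : 0 < r < 1 -> Cmod z = r -> 0 <= Re (h (r * r) z).
Proof.
  intros hr hz.
  assert (E : r * r = nsq z) by (rewrite nsq_Cmod, hz; ring). rewrite E.
  assert (n : z <> RtoC 0) by (intros ->; rewrite Cmod_0 in hz; lra).
  assert (Er : refl (nsq z) z = Cconj z).
  { unfold refl. rewrite <- Cmult_conj_nsq. field. exact n. }
  assert (EL : L (nsq z) z = Cconj (z * sq z)).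
  { unfold L. rewrite Er. unfold sq. destruct s1, s2, s3, z. unfold Cconj, Cplus, Cmult; simpl. f_equal; ring. }
  unfold h. rewrite EL.
  assert (ES : Re ((- RtoC (nsq z)) * sq_modulus_poly s1 s2 s3 (nsq z) z)%C = - nsq (z * sq z)).
  { rewrite nsq_mult. unfold sq. replace (s1 + (s2 * z + s3 * (z * z)))%C with (s1 + s2 * z + s3 * (z * z))%C by ring.
    rewrite <- sq_modulus_poly_circle. generalize (sq_modulus_poly s1 s2 s3 (nsq z) z).
    intros [p q]. simpl. ring. }
  rewrite !re_plus, ES, sq_modulus_poly_circle.
  replace (u0 + u1 * z + u2 * (z * z))%C with (u z) by (unfold u; ring).
  unfold rem. set (S := (z * sq z)%C). set (F := (w z * u z)%C).
  assert (K : nsq F <= nsq (u z)).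
  { unfold F. rewrite nsq_mult. assert (hw : in_disk (w z)) by (apply wb; unfold in_disk; lra).
    unfold in_disk in hw. rewrite (nsq_Cmod (w z)). pose proof (Cmod_ge_0 (w z)).
    pose proof (nsq_ge_0 (u z)). assert (Cmod (w z) * Cmod (w z) <= 1) by nra. nra. }
  pose proof (nsq_ge_0 (F - S)%C) as K2.
  assert (I : - nsq S + Re (- (2) * (Cconj S * (F + - (1) * S)))%C = nsq (F - S)%C - nsq F).
  { clearbody S F. destruct S, F. unfold nsq. simpl. ring. }
  lra.
Qed.

(** Parseval's inequality for w u, truncated, on the circles of radius r < 1;
    then r tends to 1. *)
Lemma schwarz_toeplitz_entry :
  nsq s1 + nsq s2 + nsq s3 <= nsq u0 + nsq u1 + nsq u2.
Proof.
  set (N := nsq u0 + nsq u1 + nsq u2). set (Sg := nsq s1 + nsq s2 + nsq s3).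
  pose proof (nsq_ge_0 u0). pose proof (nsq_ge_0 u1). pose proof (nsq_ge_0 u2).
  pose proof (nsq_ge_0 s1). pose proof (nsq_ge_0 s2). pose proof (nsq_ge_0 s3).
  assert (hS : 0 <= Sg) by (unfold Sg; lra).
  assert (K : forall r, 0 < r < 1 -> r ^ 6 * Sg <= N).
  { intros r hr. destruct (h_C1 (r * r)) as [h' Hh].
    pose proof (Re_center_nonneg (h (r * r)) h' (fun z hz => proj1 (Hh z hz))
      (fun z hz => proj2 (Hh z hz)) r hr (h_cont_0 (r * r) ltac:(nra))
      (fun z hz => h_circle r z hr hz)) as P.
    rewrite h_at_0 in P. simpl Re in P. set (x := r * r) in *.
    assert (hx : 0 < x < 1) by (unfold x; nra).
    replace (r ^ 6) with (x * (x * x)) by (unfold x; ring).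
    assert (0 <= x * x <= 1) by nra. assert (x * (x * x) <= x) by nra.
    assert (x * (x * x) <= x * x) by nra.
    assert (0 <= x * (x * x)) by nra.
    assert (nsq u1 * x <= nsq u1) by nra. assert (nsq u2 * (x * x) <= nsq u2) by nra.
    assert (x * (x * x) * nsq s1 <= x * nsq s1) by (apply Rmult_le_compat_r; lra).
    assert (x * (x * x) * nsq s2 <= x * x * nsq s2) by (apply Rmult_le_compat_r; lra).
    unfold N, Sg. lra. }
  apply le_epsilon. intros e he.
  set (t := e / (6 * Sg + 2 * e)).
  assert (ht : 0 < t < 1).
  { split; [apply Rdiv_lt_0_compat; lra|]. unfold t. apply Rmult_lt_reg_r with (6 * Sg + 2 * e); [lra|].
    unfold Rdiv. rewrite Rmult_assoc, Rinv_l by lra. lra. }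
  assert (tS : 6 * t * Sg <= e).
  { assert (E : t * (6 * Sg + 2 * e) = e) by (unfold t; field; lra). nra. }
  specialize (K (1 - t) ltac:(lra)).
  assert (B : 1 - 6 * t <= (1 - t) ^ 6).
  { assert (0 <= t * t) by nra.
    assert (1 - 2 * t <= (1 - t) ^ 2) by nra.
    assert (1 - 3 * t <= (1 - t) ^ 3) by nra.
    destruct (Rle_lt_dec (1 - 3 * t) 0) as [l|l].
    - assert (0 <= (1 - t) ^ 6) by (apply pow_le; lra). lra.
    - replace ((1 - t) ^ 6) with ((1 - t) ^ 3 * (1 - t) ^ 3) by ring. nra. }
  nra.
Qed.
End Schwarz.

Lemma schwarz_toeplitz (w w' : C -> C) (c1 c2 c3 : C) :
  (forall z, in_disk z -> cder w z (w' z)) -> (forall z, in_disk z -> ccont w' z) ->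
  (forall z, in_disk z -> in_disk (w z)) ->
  flat_at_0 4 (fun z => w z - (c1 * z + c2 * (z * z) + c3 * (z * z * z)))%C ->
  toeplitz_contraction c1 c2 c3.
Proof. intros H1 H2 H3 H4 u0 u1 u2. eapply schwarz_toeplitz_entry; eassumption. Qed.

(** * Jets at the origin *)

Lemma flat_ext (n : nat) (f g : C -> C) (r : R) : 0 < r ->
  (forall z, Cmod z < r -> f z = g z) -> flat_at_0 n f -> flat_at_0 n g.
Proof.
  intros hr E [M [d [hM [hd H]]]]. exists M, (Rmin d r).
  split; [exact hM|]. split; [apply Rmin_pos; assumption|]. intros z hz.
  rewrite <- E by (eapply Rlt_le_trans; [exact hz|apply Rmin_r]).
  apply H. eapply Rlt_le_trans; [exact hz|apply Rmin_l].
Qed.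

Lemma flat_le (m n : nat) (f : C -> C) : (m <= n)%nat -> flat_at_0 n f -> flat_at_0 m f.
Proof.
  intros l [M [d [hM [hd H]]]]. exists M, (Rmin d 1).
  split; [exact hM|]. split; [apply Rmin_pos; lra|]. intros z hz.
  eapply Rle_trans; [apply H; eapply Rlt_le_trans; [exact hz|apply Rmin_l]|].
  apply Rmult_le_compat_l; [exact hM|].
  assert (z1 : Cmod z < 1) by (eapply Rlt_le_trans; [exact hz|apply Rmin_r]).
  replace n with (m + (n - m))%nat by lia. rewrite pow_add.
  pose proof (Cmod_ge_0 z) as z0.
  assert (0 <= Cmod z ^ m) by (apply pow_le, z0).
  assert (Cmod z ^ (n - m) <= 1).
  { rewrite <- (pow1 (n - m)). apply pow_incr. lra. }
  nra.
Qed.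

Lemma flat_plus (n : nat) (f g : C -> C) :
  flat_at_0 n f -> flat_at_0 n g -> flat_at_0 n (fun z => f z + g z)%C.
Proof.
  intros [M1 [d1 [hM1 [hd1 H1]]]] [M2 [d2 [hM2 [hd2 H2]]]].
  exists (M1 + M2), (Rmin d1 d2). split; [lra|]. split; [apply Rmin_pos; assumption|].
  intros z hz. eapply Rle_trans; [apply Cmod_triangle|]. rewrite Rmult_plus_distr_r.
  apply Rplus_le_compat; [apply H1|apply H2]; (eapply Rlt_le_trans; [exact hz|]);
    [apply Rmin_l|apply Rmin_r].
Qed.

Lemma flat_mult (m n : nat) (f g : C -> C) :
  flat_at_0 m f -> flat_at_0 n g -> flat_at_0 (m + n) (fun z => f z * g z)%C.
Proof.
  intros [M1 [d1 [hM1 [hd1 H1]]]] [M2 [d2 [hM2 [hd2 H2]]]].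
  exists (M1 * M2), (Rmin d1 d2). split; [nra|]. split; [apply Rmin_pos; assumption|].
  intros z hz. rewrite Cmod_mult, pow_add.
  replace (M1 * M2 * (Cmod z ^ m * Cmod z ^ n)) with (M1 * Cmod z ^ m * (M2 * Cmod z ^ n)) by ring.
  apply Rmult_le_compat; try apply Cmod_ge_0; [apply H1|apply H2];
    (eapply Rlt_le_trans; [exact hz|]); [apply Rmin_l|apply Rmin_r].
Qed.

Lemma flat_0_of_ccont (f : C -> C) : ccont f (RtoC 0) -> flat_at_0 0 f.
Proof.
  intros H. destruct (ccont_bounded f _ H) as [d [hd K]].
  exists (Cmod (f (RtoC 0)) + 1), d. pose proof (Cmod_ge_0 (f (RtoC 0))).
  split; [lra|]. split; [exact hd|]. intros z hz. simpl. rewrite Rmult_1_r.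
  apply K. rewrite Cminus_0_r. exact hz.
Qed.

Lemma flat_id : flat_at_0 1 (fun z => z).
Proof. exists 1, 1. split; [lra|]. split; [lra|]. intros; simpl; lra. Qed.

Lemma flat_1_of_cder (f : C -> C) (l : C) : cder f (RtoC 0) l -> f (RtoC 0) = RtoC 0 ->
  flat_at_0 1 f.
Proof.
  intros H f0. apply cder_iff_slope in H. destruct H as [g [Hg [_ [d [hd E]]]]].
  apply (flat_ext 1 (fun z => z * g z)%C _ d hd).
  - intros z hz. rewrite (E z), f0, Cminus_0_r by (rewrite Cminus_0_r; exact hz). ring.
  - apply (flat_mult 1 0); [apply flat_id|apply flat_0_of_ccont, Hg].
Qed.

Lemma flat_integrate (n : nat) (f f' : C -> C) :
  (forall z, in_disk z -> cder f z (f' z)) -> f (RtoC 0) = RtoC 0 ->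
  flat_at_0 n f' -> flat_at_0 (S n) f.
Proof.
  intros Hd f0 [M [d [hM [hd H]]]]. exists M, (Rmin d 1).
  split; [exact hM|]. split; [apply Rmin_pos; lra|]. intros z hz.
  pose proof (Rlt_le_trans _ _ _ hz (Rmin_l _ _)) as z1.
  pose proof (Rlt_le_trans _ _ _ hz (Rmin_r _ _)) as z2.
  pose proof (Cmod_ge_0 z) as z0.
  assert (L : Cmod (f (0 + z)%C - f (RtoC 0)) <= M * Cmod z ^ n * Cmod z).
  { apply (mvi_segment f f'); intros t ht; rewrite Cplus_0_l.
    - apply Hd, in_disk_scale; assumption.
    - assert (E : Cmod (RtoC t * z) <= Cmod z).
      { rewrite Cmod_mult, Cmod_R, Rabs_pos_eq by lra. nra. }
      eapply Rle_trans; [apply H; lra|]. apply Rmult_le_compat_l; [exact hM|].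
      apply pow_incr. split; [apply Cmod_ge_0|exact E]. }
  rewrite f0, Cplus_0_l, Cminus_0_r in L. simpl. lra.
Qed.

(** Uniqueness of Taylor coefficients, one at a time. *)
Lemma flat_leading_zero (n : nat) (g : C -> C) : ccont g (RtoC 0) ->
  flat_at_0 (S n) (fun z => z ^ n * g z)%C -> g (RtoC 0) = RtoC 0.
Proof.
  intros Hg [M [d [hM [hd H]]]].
  destruct (Ceq_dec (g (RtoC 0)) (RtoC 0)) as [e|ne]; [exact e|exfalso].
  destruct (ccont_away g _ Hg ne) as [d' [hd' K]].
  assert (p : 0 < Cmod (g (RtoC 0))) by (apply Cmod_gt_0; exact ne).
  set (m := Cmod (g (RtoC 0)) / 2) in *.
  set (t := Rmin (Rmin d d') (m / (M + 1)) / 2).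
  assert (ht : 0 < t /\ t < d /\ t < d' /\ t < m / (M + 1)).
  { assert (0 < Rmin (Rmin d d') (m / (M + 1))).
    { repeat apply Rmin_pos; auto. apply Rdiv_lt_0_compat; unfold m; lra. }
    pose proof (Rmin_l (Rmin d d') (m / (M + 1))). pose proof (Rmin_r (Rmin d d') (m / (M + 1))).
    pose proof (Rmin_l d d'). pose proof (Rmin_r d d'). unfold t; lra. }
  assert (ct : Cmod (RtoC t) = t) by (rewrite Cmod_R, Rabs_pos_eq; lra).
  specialize (H (RtoC t) ltac:(lra)). specialize (K (RtoC t) ltac:(rewrite Cminus_0_r; lra)).
  rewrite Cmod_mult, Cmod_pow, ct in H. simpl in H.
  assert (tn : 0 < t ^ n) by (apply pow_lt; lra).
  assert (H' : Cmod (g (RtoC t)) <= M * t).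
  { apply Rmult_le_reg_l with (t ^ n); [exact tn|]. lra. }
  assert (t * (M + 1) < m).
  { apply Rmult_lt_reg_r with (/ (M + 1)); [apply Rinv_0_lt_compat; lra|].
    rewrite Rmult_assoc, Rinv_r by lra. unfold Rdiv in ht. lra. }
  lra.
Qed.

(** Second-order Taylor expansion at the origin, with a cubic remainder. *)
Definition jet2 (f : C -> C) (x0 x1 x2 : C) : Prop :=
  flat_at_0 3 (fun z => f z - (x0 + x1 * z + x2 * (z * z)))%C.

Lemma jet2_ext (f g : C -> C) (x0 x1 x2 : C) : (forall z, f z = g z) ->
  jet2 f x0 x1 x2 -> jet2 g x0 x1 x2.
Proof. intros E. apply flat_ext with 1; [lra|]. intros z _. rewrite E. reflexivity. Qed.

Lemma jet2_plus (f g : C -> C) (x0 x1 x2 y0 y1 y2 : C) :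
  jet2 f x0 x1 x2 -> jet2 g y0 y1 y2 ->
  jet2 (fun z => f z + g z)%C (x0 + y0) (x1 + y1) (x2 + y2).
Proof.
  intros H1 H2. eapply flat_ext; [apply Rlt_0_1| |apply (flat_plus _ _ _ H1 H2)].
  intros z _. cbv beta. ring.
Qed.

Lemma jet2_poly (x0 x1 x2 : C) : jet2 (fun z => x0 + x1 * z + x2 * (z * z))%C x0 x1 x2.
Proof.
  exists 0, 1. split; [lra|]. split; [lra|]. intros z _.
  replace (_ - _)%C with (RtoC 0) by ring. rewrite Cmod_0. lra.
Qed.

Lemma flat_0_poly (x0 x1 x2 : C) : flat_at_0 0 (fun z => x0 + x1 * z + x2 * (z * z))%C.
Proof.
  apply flat_0_of_ccont.
  repeat first [apply ccont_id|apply ccont_const|apply ccont_plus|apply ccont_mult].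
Qed.

Lemma jet2_mult (f g : C -> C) (x0 x1 x2 y0 y1 y2 : C) :
  jet2 f x0 x1 x2 -> jet2 g y0 y1 y2 ->
  jet2 (fun z => f z * g z)%C (x0 * y0) (x0 * y1 + x1 * y0) (x0 * y2 + x1 * y1 + x2 * y0).
Proof.
  intros H1 H2.
  pose proof (flat_0_poly x0 x1 x2) as P1. pose proof (flat_0_poly y0 y1 y2) as P2.
  assert (K1 : flat_at_0 0 f).
  { eapply flat_ext; [apply Rlt_0_1| |apply (flat_plus _ _ _ P1 (flat_le 0 3 _ ltac:(lia) H1))].
    intros z _. cbv beta. ring. }
  pose proof (flat_mult _ _ _ _ K1 H2) as Q1.
  pose proof (flat_mult _ _ _ _ H1 P2) as Q2.
  assert (Q3 : flat_at_0 3 (fun z => z * (z * (z * (x1 * y2 + x2 * y1 + (x2 * y2) * z + RtoC 0 * (z * z)))))%C).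
  { apply (flat_mult 1 2); [apply flat_id|]. apply (flat_mult 1 1); [apply flat_id|].
    apply (flat_mult 1 0); [apply flat_id|]. apply flat_0_poly. }
  eapply flat_ext; [apply Rlt_0_1| |apply (flat_plus _ _ _ (flat_plus _ _ _ Q1 Q2) Q3)].
  intros z _. cbv beta. ring.
Qed.

Lemma jet2_const (k : C) : jet2 (fun _ => k) k (RtoC 0) (RtoC 0).
Proof. refine (jet2_ext _ _ _ _ _ _ (jet2_poly k (RtoC 0) (RtoC 0))). intros z. ring. Qed.

Lemma jet2_id : jet2 (fun z => z) (RtoC 0) (RtoC 1) (RtoC 0).
Proof. refine (jet2_ext _ _ _ _ _ _ (jet2_poly (RtoC 0) (RtoC 1) (RtoC 0))). intros z. ring. Qed.

Lemma jet2_flat (f : C -> C) (x0 x1 x2 : C) : jet2 f x0 x1 x2 ->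
  x0 = RtoC 0 -> x1 = RtoC 0 -> x2 = RtoC 0 -> flat_at_0 3 f.
Proof.
  intros H -> -> ->. eapply flat_ext; [apply Rlt_0_1| |exact H]. intros z _. cbv beta. ring.
Qed.

Lemma CPS_0 (a : nat -> C) : disk_coef a -> CPS a (RtoC 0) = a 0%nat.
Proof.
  intros H. rewrite CPS_decr by (auto; unfold in_disk; rewrite Cmod_0; lra). ring.
Qed.

Lemma jet2_CPS (a : nat -> C) : disk_coef a -> jet2 (CPS a) (a 0%nat) (a 1%nat) (a 2%nat).
Proof.
  intros H. pose proof (disk_coef_shift _ H) as H1. pose proof (disk_coef_shift _ H1) as H2.
  pose proof (disk_coef_shift _ H2) as H3.
  assert (Q : flat_at_0 3 (fun z => z * (z * (z * CPS (shift (shift (shift a))) z)))%C).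
  { apply (flat_mult 1 2); [apply flat_id|]. apply (flat_mult 1 1); [apply flat_id|].
    apply (flat_mult 1 0); [apply flat_id|]. apply flat_0_of_ccont.
    eapply cder_ccont, cder_CPS; [exact H3|unfold in_disk; rewrite Cmod_0; lra]. }
  eapply flat_ext; [apply Rlt_0_1| |exact Q]. intros z hz. cbv beta.
  rewrite (CPS_decr a z), (CPS_decr (shift a) z), (CPS_decr (shift (shift a)) z) by (auto; exact hz).
  unfold shift. ring.
Qed.

(** * Coefficients of the Schwarz function *)

(** The second and third Taylor coefficients of z f' / f; the first one is a2. *)
Definition quot2 (a2 a3 : C) : C := (2 * a3 - a2 * a2)%C.
Definition quot3 (a2 a3 a4 : C) : C :=
  (3 * a4 - 3 * (a2 * a3) + a2 * a2 * a2)%C.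

(** The Taylor coefficients of w, obtained by comparing coefficients in
    (1 - w)^(-s) = z f' / f. *)
Definition sch1 (s : R) (a2 : C) : C := (a2 / RtoC s)%C.
Definition sch2 (s : R) (a2 a3 : C) : C :=
  (quot2 a2 a3 / RtoC s - (RtoC s + 1) / 2 * (sch1 s a2 * sch1 s a2))%C.
Definition sch3 (s : R) (a2 a3 a4 : C) : C :=
  (quot3 a2 a3 a4 / RtoC s - (RtoC s + 1) * (sch1 s a2 * sch2 s a2 a3)
   - (RtoC s + 1) * (RtoC s + 2) / 6 * (sch1 s a2 * sch1 s a2 * sch1 s a2))%C.

Lemma hankel_in_schwarz (s : R) (a2 a3 a4 : C) : s <> 0 ->
  (a2 * a4 - a3 ^ 2)%C = (RtoC s * RtoC s *
    hankel_schwarz s (sch1 s a2) (sch2 s a2 a3) (sch3 s a2 a3 a4))%C.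
Proof.
  intros hs. assert (hs' : RtoC s <> RtoC 0) by (intros E; apply RtoC_inj in E; contradiction).
  unfold hankel_schwarz, sch3, sch2, sch1, quot3, quot2, Rdiv.
  rewrite !RtoC_mult, !RtoC_minus, !RtoC_plus, RtoC_mult, RtoC_opp, !RtoC_inv by lra.
  field. repeat split; auto; intros E; apply RtoC_inj in E; lra.
Qed.

Lemma cder_unique (f : C -> C) (z l m : C) : cder f z l -> cder f z m -> l = m.
Proof. intros H1 H2. rewrite <- (is_C_derive_unique _ _ _ H1). apply is_C_derive_unique, H2. Qed.

Lemma disk_0 : in_disk (RtoC 0).
Proof. unfold in_disk. rewrite Cmod_0. lra. Qed.

Lemma disk_loc (z : C) : in_disk z -> exists r, 0 < r /\ forall w, Cmod (w - z) < r -> in_disk w.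
Proof.
  intros hz. exists (1 - Cmod z). unfold in_disk in *. split; [lra|]. intros w hw.
  replace w with ((w - z) + z)%C by ring. eapply Rle_lt_trans; [apply Cmod_triangle|]. lra.
Qed.

Lemma cder_ext_disk (f g : C -> C) (z l : C) : in_disk z ->
  (forall w, in_disk w -> f w = g w) -> cder f z l -> cder g z l.
Proof.
  intros hz E H. destruct (disk_loc z hz) as [r [hr K]].
  apply (cder_ext_loc f g z l r hr); auto.
Qed.

Section Coefficients.
Variables (s : R) (f w : C -> C) (a : nat -> C).
Hypothesis hs : 0 < s.
Hypothesis Hf : class_S f.
Hypothesis Ha : normalized_expansion f a.
Hypothesis Hw : schwarz_function w.
Hypothesis Hq : forall z, in_disk z -> starlike_quotient f z = q_hpl s (w z).

Let b := shift a.
Let F := CPS b.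
Let F1 := CPS (deriv_coef b).
Let F2 := CPS (deriv_coef (deriv_coef b)).

Lemma expansion_coef : disk_coef a.
Proof.
  apply (disk_coef_of_pseries a f). intros z hz. apply is_pseries_csum. apply Ha, hz.
Qed.

Lemma b_coef : disk_coef b.
Proof. apply disk_coef_shift, expansion_coef. Qed.

Lemma f_factor (z : C) : in_disk z -> f z = (z * F z)%C.
Proof.
  intros hz. destruct Ha as [a0 [_ H]].
  rewrite <- (CPS_unique a z (f z)); auto using expansion_coef.
  - rewrite CPS_decr by auto using expansion_coef. rewrite a0. unfold F, b. ring.
  - apply is_pseries_csum, H, hz.
Qed.

Lemma F_0 : F (RtoC 0) = RtoC 1.
Proof. unfold F. rewrite CPS_0 by apply b_coef. apply Ha. Qed.

Lemma F_neq_0 (z : C) : in_disk z -> F z <> RtoC 0.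
Proof.
  intros hz E. destruct Hf as [_ [inj _]].
  assert (z = RtoC 0).
  { apply inj; auto using disk_0. rewrite !f_factor, E by auto using disk_0. ring. }
  subst z. rewrite F_0 in E. apply RtoC_inj in E. lra.
Qed.

Lemma dF (z : C) : in_disk z -> cder F z (F1 z).
Proof. intros hz. apply cder_CPS; auto using b_coef. Qed.

Lemma dF1 (z : C) : in_disk z -> cder F1 z (F2 z).
Proof. intros hz. apply cder_CPS; auto using disk_coef_deriv, b_coef. Qed.

Lemma cF2 (z : C) : in_disk z -> ccont F2 z.
Proof. intros hz. eapply cder_ccont, cder_CPS; auto using disk_coef_deriv, b_coef. Qed.

(** z f' = q_s(w) f, divided by z; here F = f / z. *)
Lemma subordination_eq (z : C) : in_disk z -> (F z + z * F1 z = q_hpl s (w z) * F z)%C.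
Proof.
  intros hz. rewrite <- Hq by exact hz. unfold starlike_quotient.
  destruct (Ceq_dec z (RtoC 0)) as [->|n]; [ring|].
  assert (D : cder f z (F z + z * F1 z)%C).
  { apply (cder_ext_disk (fun z => z * F z)%C); [exact hz|intros; symmetry; apply f_factor; assumption|].
    eapply cder_eq; [apply cder_mult; [apply cder_id|apply dF, hz]|]. cbv beta; ring. }
  rewrite (is_C_derive_unique _ _ _ D), f_factor by exact hz. field. split; auto using F_neq_0.
Qed.

Let num (z : C) := (F z * F1 z + z * (F z * F2 z + (- (1)) * (F1 z * F1 z)))%C.
Let den (z : C) := (RtoC s * ((F z + z * F1 z) * F z))%C.
Let w' (z : C) := ((1 + (- (1)) * w z) * (num z * / den z))%C.

Lemma s_neq_0 : RtoC s <> RtoC 0.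
Proof. intros E; apply RtoC_inj in E; lra. Qed.

Lemma den_neq_0 (z : C) : in_disk z -> den z <> RtoC 0.
Proof.
  intros hz. unfold den. rewrite subordination_eq by exact hz.
  repeat apply Cmult_neq_0; auto using F_neq_0, q_hpl_neq_0, s_neq_0.
Qed.

(** Differentiating the subordination and eliminating q_s(w) leaves the equation
    w' = (1 - w) num / den, whose coefficients are power series. This gives w a
    continuous derivative, and its Taylor expansion below. *)
Lemma schwarz_ode (z : C) : in_disk z -> cder w z (w' z).
Proof.
  intros hz. destruct Hw as [hol [bd w0]].
  assert (hwz := bd z hz).
  destruct (hol z hz) as [l' Hl]. set (l := l' : C). change (cder w z l) in Hl. clearbody l.
  assert (D1 : cder (fun z => F z + z * F1 z)%C z (2 * F1 z + z * F2 z)%C).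
  { eapply cder_eq.
    - apply cder_plus; [apply dF, hz|apply cder_mult; [apply cder_id|apply dF1, hz]].
    - cbv beta. ring. }
  assert (D2 : cder (fun z => F z + z * F1 z)%C z
    (RtoC s * q_hpl s (w z) / (1 - w z) * l * F z + q_hpl s (w z) * F1 z)%C).
  { apply (cder_ext_disk (fun z => q_hpl s (w z) * F z)%C); [exact hz|intros; symmetry; apply subordination_eq; assumption|].
    apply (cder_mult (fun z => q_hpl s (w z))); [|apply dF, hz].
    apply (cder_comp (q_hpl s) w); [apply cder_q_hpl, hwz|exact Hl]. }
  assert (E : (2 * F1 z + z * F2 z)%C = (RtoC s * q_hpl s (w z) / (1 - w z) * l * F z + q_hpl s (w z) * F1 z)%C).
  { exact (cder_unique _ _ _ _ D1 D2). }
  eapply cder_eq; [exact Hl|].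
  pose proof (den_neq_0 z hz) as nd.
  pose proof (disk_1m_neq_0 _ hwz) as nw.
  pose proof (subordination_eq z hz) as E0.
  assert (K : (den z * l = (1 + (- (1)) * w z) * num z)%C).
  { transitivity ((1 - w z) * F z * ((2 * F1 z + z * F2 z) - q_hpl s (w z) * F1 z))%C.
    - rewrite E. unfold den. rewrite E0. field. exact nw.
    - unfold num.
      transitivity ((1 - w z) * (F z * (2 * F1 z + z * F2 z) - (q_hpl s (w z) * F z) * F1 z))%C; [ring|].
      rewrite <- E0. ring. }
  unfold w'. transitivity (den z * l * / den z)%C; [field; exact nd|]. rewrite K. ring.
Qed.

Lemma num_cont (z : C) : in_disk z -> ccont num z.
Proof.
  intros hz.
  assert (k0 : ccont F z) by (eapply cder_ccont, dF, hz).
  assert (k1 : ccont F1 z) by (eapply cder_ccont, dF1, hz).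
  pose proof (cF2 z hz).
  unfold num. repeat first [assumption|apply ccont_id|apply ccont_const|apply ccont_plus|apply ccont_mult].
Qed.

Lemma den_cont (z : C) : in_disk z -> ccont den z.
Proof.
  intros hz.
  assert (k0 : ccont F z) by (eapply cder_ccont, dF, hz).
  assert (k1 : ccont F1 z) by (eapply cder_ccont, dF1, hz).
  unfold den. repeat first [assumption|apply ccont_id|apply ccont_const|apply ccont_plus|apply ccont_mult].
Qed.

Lemma schwarz_derivative_cont (z : C) : in_disk z -> ccont w' z.
Proof.
  intros hz. assert (kw : ccont w z) by (eapply cder_ccont, schwarz_ode, hz).
  pose proof (num_cont z hz). pose proof (ccont_inv den z (den_cont z hz) (den_neq_0 z hz)).
  unfold w'. repeat first [assumption|apply ccont_id|apply ccont_const|apply ccont_plus|apply ccont_mult].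
Qed.

Let k1 := sch1 s (a 2%nat).
Let k2 := sch2 s (a 2%nat) (a 3%nat).
Let k3 := sch3 s (a 2%nat) (a 3%nat) (a 4%nat).
Let V (z : C) := (k1 * z + k2 * (z * z) + k3 * (z * z * z))%C.
Let V' (z : C) := (k1 + 2 * k2 * z + 3 * k3 * (z * z))%C.

Lemma dV (z : C) : cder V z (V' z).
Proof.
  eapply cder_eq.
  - unfold V. apply cder_plus; [apply cder_plus|]; (apply cder_mult; [apply cder_const|]);
      [apply cder_id|apply cder_mult; apply cder_id|].
    apply cder_mult; [apply cder_mult; apply cder_id|apply cder_id].
  - unfold V'. cbv beta. ring.
Qed.

(** The coefficients of V are chosen to make V satisfy the differential equation
    of w up to O(z^3). *)
Lemma taylor_residual : flat_at_0 3 (fun z => den z * V' z + (- (1)) * ((1 + (- (1)) * V z) * num z))%C.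
Proof.
  assert (j0 : jet2 F 1 (a 2%nat) (a 3%nat)).
  { destruct Ha as [_ [<- _]]. apply (jet2_CPS b b_coef). }
  assert (j1 : jet2 F1 (a 2%nat) (2 * a 3%nat) (3 * a 4%nat)).
  { pose proof (jet2_CPS _ (disk_coef_deriv _ b_coef)) as J.
    unfold deriv_coef, b, shift in J. rewrite !S_INR in J. simpl INR in J.
    replace (RtoC (0 + 1) * a 2%nat)%C with (a 2%nat) in J by (rewrite Rplus_0_l; ring).
    replace (0 + 1 + 1) with 2 in J by ring. replace (2 + 1) with 3 in J by ring. exact J. }
  assert (j2 : jet2 F2 (2 * a 3%nat) (6 * a 4%nat) (12 * a 5%nat)).
  { pose proof (jet2_CPS _ (disk_coef_deriv _ (disk_coef_deriv _ b_coef))) as J.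
    unfold deriv_coef, b, shift in J. rewrite !S_INR in J. simpl INR in J.
    rewrite !Cmult_assoc, <- !RtoC_mult in J.
    replace ((0 + 1) * (0 + 1 + 1)) with 2 in J by ring.
    replace ((0 + 1 + 1) * (0 + 1 + 1 + 1)) with 6 in J by ring.
    replace ((0 + 1 + 1 + 1) * (0 + 1 + 1 + 1 + 1)) with 12 in J by ring. exact J. }
  assert (jV : jet2 V 0 k1 k2).
  { assert (Q : flat_at_0 3 (fun z => z * (z * (z * (k3 + RtoC 0 * z + RtoC 0 * (z * z)))))%C).
    { apply (flat_mult 1 2); [apply flat_id|]. apply (flat_mult 1 1); [apply flat_id|].
      apply (flat_mult 1 0); [apply flat_id|]. apply flat_0_poly. }
    eapply flat_ext; [apply Rlt_0_1| |exact Q]. intros z _. unfold V. ring. }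
  assert (jV' : jet2 V' k1 (2 * k2) (3 * k3)) by apply jet2_poly.
  pose proof s_neq_0 as ns.
  eapply jet2_flat.
  - unfold den, num.
    repeat first [exact j0|exact j1|exact j2|exact jV|exact jV'|apply jet2_id|apply jet2_const|apply jet2_plus|apply jet2_mult].
  - unfold k1, k2, k3, sch3, sch2, sch1, quot3, quot2. field. exact ns.
  - unfold k1, k2, k3, sch3, sch2, sch1, quot3, quot2. field. exact ns.
  - unfold k1, k2, k3, sch3, sch2, sch1, quot3, quot2. field.
    repeat split; auto; intros E; apply RtoC_inj in E; lra.
Qed.

(** For phi = w - V the equations give den phi' = - num phi + O(z^3), so each
    integration improves phi = O(z^n) by one order, up to n = 4. *)
Lemma schwarz_taylor : flat_at_0 4 (fun z => w z - V z)%C.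
Proof.
  set (phi := fun z => (w z + (- (1)) * V z)%C).
  set (phi' := fun z => (w' z + (- (1)) * V' z)%C).
  assert (Dphi : forall z, in_disk z -> cder phi z (phi' z)).
  { intros z hz. eapply cder_eq.
    - apply cder_plus; [apply schwarz_ode, hz|apply cder_mult; [apply cder_const|apply dV]].
    - unfold phi'. ring. }
  assert (phi0 : phi (RtoC 0) = RtoC 0).
  { unfold phi, V. destruct Hw as [_ [_ ->]]. ring. }
  assert (i0 : flat_at_0 0 (fun z => / den z)%C).
  { apply flat_0_of_ccont, ccont_inv; [apply den_cont|apply den_neq_0]; apply disk_0. }
  assert (step : forall n, (n <= 3)%nat -> flat_at_0 n phi -> flat_at_0 (S n) phi).
  { intros n hn Hn. apply (flat_integrate n phi phi'); auto.
    pose proof (flat_mult n 0 _ _ Hn (flat_0_of_ccont _ (num_cont _ disk_0))) as P1.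
    rewrite Nat.add_0_r in P1.
    pose proof (flat_plus _ _ _ P1 (flat_le n 3 _ hn taylor_residual)) as P2.
    pose proof (flat_mult n 0 _ _ P2 i0) as P3. rewrite Nat.add_0_r in P3.
    assert (m1 : flat_at_0 0 (fun _ => (- (1))%C)) by apply flat_0_of_ccont, ccont_const.
    pose proof (flat_mult 0 n _ _ m1 P3) as P4.
    refine (flat_ext _ _ _ 1 Rlt_0_1 _ P4). intros z hz. cbv beta.
    pose proof (den_neq_0 z hz) as nd. unfold phi', phi, w'.
    generalize dependent (den z). intros D nD. field. exact nD. }
  refine (flat_ext 4 phi _ 1 Rlt_0_1 _ _); [intros z _; unfold phi; ring|].
  apply step; [lia|]. apply step; [lia|]. apply step; [lia|].
  apply (flat_1_of_cder phi (phi' (RtoC 0))); [apply Dphi, disk_0|exact phi0].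
Qed.

Lemma hankel_bound : s <= 1 -> Cmod (a 2%nat * a 4%nat - a 3%nat ^ 2)%C <= s ^ 2 / 4.
Proof.
  intros hs1. rewrite (hankel_in_schwarz s) by lra.
  assert (T : toeplitz_contraction k1 k2 k3).
  { apply (schwarz_toeplitz w w'); [exact schwarz_ode|exact schwarz_derivative_cont|apply Hw|].
    exact schwarz_taylor. }
  pose proof (hankel_schwarz_bound s k1 k2 k3 ltac:(lra) T) as L.
  rewrite !Cmod_mult, Cmod_R, Rabs_pos_eq by lra.
  apply Rle_trans with (s * s * (1 / 4)); [|lra].
  apply Rmult_le_compat_l; [nra|exact L].
Qed.

Lemma hankel_extremal (nu : C) : Cmod nu = 1 -> (forall z, in_disk z -> w z = (nu * (z * z))%C) ->
  Cmod (a 2%nat * a 4%nat - a 3%nat ^ 2)%C = s ^ 2 / 4.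
Proof.
  intros hnu E. rewrite (hankel_in_schwarz s) by lra. fold k1 k2 k3.
  assert (T : forall z, in_disk z -> (w z - V z)%C
    = (z ^ 1 * (- k1 + (nu - k2) * z + (- k3) * (z * z)))%C).
  { intros z hz. rewrite E by exact hz. unfold V. simpl. ring. }
  assert (cp : forall x y z : C, ccont (fun t => x + y * t + z * (t * t))%C (RtoC 0)).
  { intros. repeat first [apply ccont_id|apply ccont_const|apply ccont_plus|apply ccont_mult]. }
  pose proof (flat_ext 4 _ _ 1 Rlt_0_1 T schwarz_taylor) as P1.
  pose proof (flat_leading_zero 1 _ (cp _ _ _) (flat_le 2 4 _ ltac:(lia) P1)) as Z1. cbv beta in Z1.
  assert (z1 : k1 = RtoC 0).
  { replace k1 with (- (- k1 + (nu - k2) * 0 + (- k3) * (0 * 0)))%C by ring. rewrite Z1. ring. }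
  assert (P2 : flat_at_0 4 (fun z => z ^ 2 * ((nu - k2) + (- k3) * z + RtoC 0 * (z * z)))%C).
  { refine (flat_ext 4 _ _ 1 Rlt_0_1 _ P1). intros z _. rewrite z1. simpl. ring. }
  pose proof (flat_leading_zero 2 _ (cp _ _ _) (flat_le 3 4 _ ltac:(lia) P2)) as Z2. cbv beta in Z2.
  assert (z2 : k2 = nu).
  { replace k2 with (nu - ((nu - k2) + (- k3) * 0 + RtoC 0 * (0 * 0)))%C by ring. rewrite Z2. ring. }
  unfold hankel_schwarz. rewrite z1, z2.
  replace (RtoC s * RtoC s * _)%C with (RtoC s * RtoC s * (RtoC (- / 4) * (nu * nu)))%C by ring.
  rewrite !Cmod_mult, !Cmod_R, hnu, (Rabs_left (- / 4)), (Rabs_pos_eq s) by lra. field.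
Qed.
End Coefficients.

(** * Series with bounded real coefficients *)

Lemma disk_coef_bounded (a : nat -> C) : (forall n, Cmod (a n) <= 1) -> disk_coef a.
Proof.
  intros H r hr. exists 1. intros n. specialize (H n). pose proof (Cmod_ge_0 (a n)).
  assert (0 <= r ^ n) by (apply pow_le; lra).
  assert (r ^ n <= 1) by (rewrite <- (pow1 n); apply pow_incr; lra). nra.
Qed.

Definition real_coef (a : nat -> R) (n : nat) : C := RtoC (a n).

Lemma real_coef_disk (a : nat -> R) : (forall n, Rabs (a n) <= 1) -> disk_coef (real_coef a).
Proof. intros H. apply disk_coef_bounded. intros n. unfold real_coef. rewrite Cmod_R. apply H. Qed.

(** The four products of real and imaginary parts are Cauchy products of
    absolutely convergent real series. *)
Lemma CPS_mult (a b : nat -> R) (z : C) :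
  disk_coef (real_coef a) -> disk_coef (real_coef b) -> in_disk z ->
  csum (fun n => RtoC (sum_f_R0 (fun k => (a k * b (n - k)%nat)%R) n) * z ^ n)%C
    (CPS (real_coef a) z * CPS (real_coef b) z)%C.
Proof.
  intros Ha Hb hz.
  destruct (CPS_sum _ z Ha hz) as [a1 a2]. destruct (CPS_sum _ z Hb hz) as [b1 b2].
  assert (K : forall c, disk_coef (real_coef c) ->
    ex_series (fun n => Rabs (Re (real_coef c n * z ^ n)%C)) /\
    ex_series (fun n => Rabs (Im (real_coef c n * z ^ n)%C))).
  { intros c Hc. pose proof (disk_coef_series _ (Cmod z) Hc (conj (Cmod_ge_0 z) hz)) as S.
    split; apply (ex_series_le (V := R_CompleteNormedModule) _ (fun n => Cmod (real_coef c n) * Cmod z ^ n));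
      auto; intros n; unfold norm; simpl; unfold abs; simpl; rewrite Rabs_Rabsolu, <- Cmod_pow, <- Cmod_mult.
    - apply (abs_Re (real_coef c n * z ^ n)%C).
    - apply (abs_Im (real_coef c n * z ^ n)%C). }
  destruct (K a Ha) as [a3 a4]. destruct (K b Hb) as [b3 b4].
  assert (T : forall n k, (k <= n)%nat ->
    (real_coef a k * z ^ k * (real_coef b (n - k)%nat * z ^ (n - k)))%C = (RtoC (a k * b (n - k)%nat)%R * z ^ n)%C).
  { intros n k hk. rewrite RtoC_mult. unfold real_coef.
    replace (z ^ n)%C with (z ^ k * z ^ (n - k))%C; [ring|].
    rewrite <- Cpow_add_r. f_equal. lia. }
  split.
  - eapply is_series_ext; [|apply (is_series_minus (V := R_NormedModule)); [apply (is_series_mult _ _ _ _ a1 b1 a3 b3)|apply (is_series_mult _ _ _ _ a2 b2 a4 b4)]].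
    intros n. cbv beta. etransitivity; [symmetry; apply minus_sum|].
    transitivity (sum_f_R0 (fun k => a k * b (n - k)%nat * Re (z ^ n)%C) n).
    + apply sum_eq. intros k hk.
      transitivity (Re (real_coef a k * z ^ k * (real_coef b (n - k)%nat * z ^ (n - k)))%C); [reflexivity|].
      rewrite T by exact hk. generalize (a k * b (n - k)%nat) (z ^ n)%C. intros S [p q]. simpl. ring.
    + rewrite <- scal_sum. generalize (sum_f_R0 (fun k => a k * b (n - k)%nat) n) (z ^ n)%C.
      intros S [p q]. simpl. ring.
  - eapply is_series_ext; [|apply (is_series_plus (V := R_NormedModule)); [apply (is_series_mult _ _ _ _ a1 b2 a3 b4)|apply (is_series_mult _ _ _ _ a2 b1 a4 b3)]].
    intros n. cbv beta. etransitivity; [symmetry; apply plus_sum|].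
    transitivity (sum_f_R0 (fun k => a k * b (n - k)%nat * Im (z ^ n)%C) n).
    + apply sum_eq. intros k hk.
      transitivity (Im (real_coef a k * z ^ k * (real_coef b (n - k)%nat * z ^ (n - k)))%C); [reflexivity|].
      rewrite T by exact hk. generalize (a k * b (n - k)%nat) (z ^ n)%C. intros S [p q]. simpl. ring.
    + rewrite <- scal_sum. generalize (sum_f_R0 (fun k => a k * b (n - k)%nat) n) (z ^ n)%C.
      intros S [p q]. simpl. ring.
Qed.

(** * The exponential of the primitive of a power series *)

Section Exponential.
Variable Q : nat -> R.
Hypothesis HQ : forall n, Rabs (Q n) <= 1.

(** Coefficients of B = exp (primitive of Q), from B' = Q B. The recursion is over
    all previous values: exp_coef_upto n agrees with the final sequence up to n. *)
Fixpoint exp_coef_upto (n : nat) : nat -> R :=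
  match n with
  | O => fun _ => 1
  | S m => fun k =>
      if Nat.leb k m then exp_coef_upto m k
      else / INR (S m) * sum_f_R0 (fun j => Q j * exp_coef_upto m (m - j)%nat) m
  end.
Definition exp_coef (n : nat) : R := exp_coef_upto n n.

Lemma exp_coef_upto_le (n k : nat) : (k <= n)%nat -> exp_coef_upto n k = exp_coef k.
Proof.
  intros H. induction n.
  - replace k with 0%nat by lia. reflexivity.
  - destruct (Nat.eq_dec k (S n)) as [->|ne]; [reflexivity|].
    simpl. rewrite (proj2 (Nat.leb_le k n)) by lia. apply IHn. lia.
Qed.

Lemma exp_coef_rec (n : nat) :
  INR (S n) * exp_coef (S n) = sum_f_R0 (fun k => Q k * exp_coef (n - k)%nat) n.
Proof.
  unfold exp_coef at 1. cbn [exp_coef_upto].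
  rewrite (proj2 (Nat.leb_gt (S n) n)) by lia.
  rewrite <- Rmult_assoc, Rinv_r, Rmult_1_l by (apply not_0_INR; lia).
  apply sum_eq. intros k hk. rewrite exp_coef_upto_le by lia. reflexivity.
Qed.

Lemma sum_f_R0_abs_le (x : nat -> R) (n : nat) : (forall k, (k <= n)%nat -> Rabs (x k) <= 1) ->
  Rabs (sum_f_R0 x n) <= INR (S n).
Proof.
  induction n; intros H.
  - simpl. apply H. lia.
  - rewrite tech5, (S_INR (S n)). eapply Rle_trans; [apply Rabs_triang|].
    apply Rplus_le_compat; [apply IHn; intros; apply H; lia|apply H; lia].
Qed.

(** (n + 1) times a new coefficient is a sum of n + 1 terms of modulus at most
    one; this makes the series of the exponential converge in the disk. *)
Lemma exp_coef_bound (n : nat) : Rabs (exp_coef n) <= 1.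
Proof.
  induction n as [n IH] using lt_wf_ind.
  destruct n as [|n].
  - unfold exp_coef; simpl. rewrite Rabs_R1. lra.
  - assert (p : 0 < INR (S n)) by (apply lt_0_INR; lia).
    apply Rmult_le_reg_l with (INR (S n)); [exact p|].
    rewrite <- (Rabs_pos_eq (INR (S n))) at 1 by lra.
    rewrite <- Rabs_mult, exp_coef_rec, Rmult_1_r.
    apply sum_f_R0_abs_le. intros k hk. rewrite Rabs_mult.
    specialize (IH (n - k)%nat ltac:(lia)). specialize (HQ k).
    pose proof (Rabs_pos (Q k)). pose proof (Rabs_pos (exp_coef (n - k))). nra.
Qed.

Definition prim_coef (n : nat) : R := match n with O => 0 | S m => Q m / INR (S m) end.

Lemma prim_coef_bound (n : nat) : Rabs (prim_coef n) <= 1.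
Proof.
  destruct n as [|n]; unfold prim_coef; [rewrite Rabs_R0; lra|].
  assert (1 <= INR (S n)) by (rewrite S_INR; pose proof (pos_INR n); lra).
  rewrite Rabs_div, (Rabs_pos_eq (INR (S n))) by lra.
  apply Rmult_le_reg_r with (INR (S n)); [lra|]. unfold Rdiv. rewrite Rmult_assoc, Rinv_l by lra.
  specialize (HQ n). lra.
Qed.

Let Qd := real_coef_disk Q HQ.
Let Bd := real_coef_disk exp_coef exp_coef_bound.
Let Pd := real_coef_disk prim_coef prim_coef_bound.

Lemma CPS_ext (a b : nat -> C) (z : C) : (forall n, a n = b n) -> CPS a z = CPS b z.
Proof. intros H. unfold CPS. f_equal; apply Series_ext; intros n; rewrite H; reflexivity. Qed.

Lemma cder_prim (z : C) : in_disk z ->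
  cder (CPS (real_coef prim_coef)) z (CPS (real_coef Q) z).
Proof.
  intros hz. eapply cder_eq; [apply cder_CPS; [exact Pd|exact hz]|].
  apply CPS_ext. intros n. unfold deriv_coef, real_coef, prim_coef.
  rewrite <- RtoC_mult. f_equal. field. apply not_0_INR. lia.
Qed.

Lemma prim_0 : CPS (real_coef prim_coef) (RtoC 0) = RtoC 0.
Proof. rewrite CPS_0 by exact Pd. reflexivity. Qed.

(** Both sides solve y' = Q y with y(0) = 1. *)
Lemma CPS_exp (z : C) : in_disk z ->
  CPS (real_coef exp_coef) z = Cexp (CPS (real_coef prim_coef) z).
Proof.
  apply (linear_ode_unique (CPS (real_coef exp_coef)) (fun z => Cexp (CPS (real_coef prim_coef) z))
    (CPS (real_coef Q))).
  - intros w hw. eapply cder_eq; [apply cder_CPS; [exact Bd|exact hw]|].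
    apply CPS_unique; [|apply disk_coef_deriv, Bd|exact hw].
    eapply csum_ext; [|apply (CPS_mult Q exp_coef w Qd Bd hw)].
    intros n. cbv beta. rewrite <- exp_coef_rec. unfold deriv_coef, real_coef.
    rewrite RtoC_mult. reflexivity.
  - intros w hw. eapply cder_eq; [apply cder_comp; [apply cder_Cexp|apply cder_prim, hw]|]. ring.
  - intros w hw. apply Cexp_neq_0.
  - rewrite prim_0, Cexp_0, CPS_0 by exact Bd. reflexivity.
Qed.
End Exponential.

(** * The binomial series of q_s(z^2) *)

Section Extremal.
Variable s : R.
Hypothesis hs : 0 < s <= 1.

(** The expansion of (1 - z^2)^(-s), by the recursion that
    (1 - z^2) y' = 2 s z y imposes on the coefficients; s <= 1 keeps them in
    [0, 1]. *)
Fixpoint binom_coef (n : nat) : R :=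
  match n with
  | O => 1
  | S O => 0
  | S (S k) => (INR k + 2 * s) / (INR k + 2) * binom_coef k
  end.

Lemma binom_coef_bound (n : nat) : Rabs (binom_coef n) <= 1.
Proof.
  induction n as [n IH] using lt_wf_ind.
  destruct n as [|[|k]]; simpl binom_coef; [rewrite Rabs_R1; lra|rewrite Rabs_R0; lra|].
  specialize (IH k ltac:(lia)). pose proof (pos_INR k).
  assert (0 <= (INR k + 2 * s) / (INR k + 2) <= 1).
  { split; [apply Rdiv_le_0_compat; lra|].
    apply Rmult_le_reg_r with (INR k + 2); [lra|]. unfold Rdiv. rewrite Rmult_assoc, Rinv_l by lra. lra. }
  rewrite Rabs_mult, Rabs_pos_eq by lra. pose proof (Rabs_pos (binom_coef k)). nra.
Qed.

Let Y := CPS (real_coef binom_coef).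
Let Yd := real_coef_disk binom_coef binom_coef_bound.
Let Y1 := CPS (deriv_coef (real_coef binom_coef)).

Lemma binom_ode (z : C) : in_disk z ->
  Y1 z = (z * (2 * RtoC s * Y z + z * Y1 z))%C.
Proof.
  intros hz. pose proof (disk_coef_deriv _ Yd) as Dd.
  pose proof (CPS_sum _ z Yd hz) as S1. pose proof (CPS_sum _ z Dd hz) as S2.
  set (e := fun n => (RtoC (INR n) * real_coef binom_coef n * z ^ n)%C).
  assert (S3 : csum e (e 0%nat + z * Y1 z)%C).
  { apply csum_incr. eapply csum_ext; [|apply (csum_scal z _ _ S2)].
    intros n. unfold e, deriv_coef. simpl Cpow. ring. }
  pose proof (csum_plus _ _ _ _ (csum_scal (2 * RtoC s) _ _ S1) S3) as S4.
  set (g := fun n => (deriv_coef (real_coef binom_coef) n * z ^ n)%C).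
  assert (S5 : csum g (g 0%nat + z * (2 * RtoC s * Y z + (e 0%nat + z * Y1 z)))%C).
  { apply csum_incr. eapply csum_ext; [|apply (csum_scal z _ _ S4)].
    intros n. unfold g, e, deriv_coef, real_coef. simpl Cpow.
    replace (binom_coef (S (S n))) with ((INR n + 2 * s) / (INR n + 2) * binom_coef n) by reflexivity.
    pose proof (pos_INR n).
    replace (RtoC (INR (S (S n))) * RtoC ((INR n + 2 * s) / (INR n + 2) * binom_coef n))%C
      with (RtoC (INR n) * RtoC (binom_coef n) + 2 * RtoC s * RtoC (binom_coef n))%C; [ring|].
    rewrite <- !RtoC_mult, <- RtoC_plus. f_equal. rewrite !S_INR. field. lra. }
  transitivity (g 0%nat + z * (2 * RtoC s * Y z + (e 0%nat + z * Y1 z)))%C.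
  - apply CPS_unique; assumption.
  - unfold g, e, deriv_coef, real_coef. simpl. ring.
Qed.

Lemma in_disk_sq (z : C) : in_disk z -> in_disk (z * z)%C.
Proof. unfold in_disk. intros h. rewrite Cmod_mult. pose proof (Cmod_ge_0 z). nra. Qed.

Lemma binom_series (z : C) : in_disk z -> Y z = q_hpl s (z * z)%C.
Proof.
  apply (linear_ode_unique Y (fun z => q_hpl s (z * z)%C) (fun z => 2 * RtoC s * z / (1 - z * z))%C).
  - intros w hw. eapply cder_eq; [apply cder_CPS; [exact Yd|exact hw]|].
    fold Y1. pose proof (binom_ode w hw) as E.
    pose proof (disk_1m_neq_0 _ (in_disk_sq w hw)) as n.
    assert (E' : (Y1 w * (1 - w * w) = 2 * RtoC s * w * Y w)%C).
    { transitivity (Y1 w - w * (w * Y1 w))%C; [ring|]. rewrite E at 1. ring. }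
    transitivity (Y1 w * (1 - w * w) / (1 - w * w))%C; [field; exact n|]. rewrite E'. field. exact n.
  - intros w hw. eapply cder_eq.
    + apply (cder_comp (q_hpl s) (fun z => z * z)%C); [apply cder_q_hpl, in_disk_sq, hw|].
      apply cder_mult; apply cder_id.
    + cbv beta. field. apply disk_1m_neq_0, in_disk_sq, hw.
  - intros w hw. apply q_hpl_neq_0.
  - rewrite Cmult_0_l, q_hpl_0. unfold Y. rewrite CPS_0 by exact Yd. reflexivity.
Qed.

(** Coefficients of (q_s(z^2) - 1) / z, which drops the constant term 1. *)
Definition ext_coef (n : nat) : R := binom_coef (S n).

Lemma ext_coef_bound (n : nat) : Rabs (ext_coef n) <= 1.
Proof. apply binom_coef_bound. Qed.

Let Qf := CPS (real_coef ext_coef).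
Let Jf := CPS (real_coef (prim_coef ext_coef)).

Lemma ext_series (z : C) : in_disk z -> (1 + z * Qf z)%C = q_hpl s (z * z)%C.
Proof.
  intros hz. rewrite <- binom_series by exact hz. unfold Y. rewrite CPS_decr by auto using Yd.
  reflexivity.
Qed.

Lemma dJ (z : C) : in_disk z -> cder Jf z (Qf z).
Proof. apply cder_prim, ext_coef_bound. Qed.

(** * The extremal function *)

(** Along the segment from 0 to z the integrand is the derivative of J, by the
    chain rule. *)
Lemma is_RInt_ext_integrand (z : C) : in_disk z ->
  is_RInt (V := C_R_CompleteNormedModule) (fun x : R => (Qf (RtoC x * z) * z)%C) 0 1 (Jf z).
Proof.
  intros hz.
  assert (K : forall k, is_RInt (V := R_NormedModule) (fun x => Re (k * (Qf (RtoC x * z) * z))%C) 0 1 (Re (k * Jf z)%C)).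
  { intros k.
    assert (L : forall x, 0 <= x <= 1 -> in_disk (0 + RtoC x * z)%C).
    { intros x hx. rewrite Cplus_0_l. apply in_disk_scale; assumption. }
    assert (E : Re (k * Jf z)%C = minus (Re (k * Jf (0 + RtoC 1 * z))%C) (Re (k * Jf (0 + RtoC 0 * z))%C)).
    { replace (0 + RtoC 1 * z)%C with z by ring. replace (0 + RtoC 0 * z)%C with (RtoC 0) by ring.
      unfold Jf at 3. rewrite prim_0 by apply ext_coef_bound. rewrite Cmult_0_r.
      unfold minus, plus, opp; simpl. ring. }
    rewrite E.
    apply (is_RInt_ext (fun x => Re (k * (Qf (0 + RtoC x * z) * z))%C)).
    { intros x _. rewrite Cplus_0_l. reflexivity. }
    apply (is_RInt_derive (V := R_CompleteNormedModule) (fun x => Re (k * Jf (0 + RtoC x * z))%C));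
      rewrite Rmin_left, Rmax_right by lra; intros x hx.
    - apply deriv_segment, dJ, L, hx.
    - apply (continuous_ext (fun x => Re (k * z * Qf (0 + RtoC x * z))%C)).
      { intros t. f_equal. ring. }
      apply (ex_derive_continuous (K := R_AbsRing) (V := R_NormedModule)).
      eexists. apply deriv_segment. apply cder_CPS; [apply real_coef_disk, ext_coef_bound|apply L, hx]. }
  assert (Z : forall w : C, Re (- Ci * w)%C = Im w) by (intros [p q]; simpl; ring).
  assert (O : forall w : C, Re (1 * w)%C = Re w) by (intros [p q]; simpl; ring).
  pose proof (K (RtoC 1)) as K1. pose proof (K (- Ci)%C) as K2. rewrite O in K1. rewrite Z in K2.
  rewrite (surjective_pairing (Jf z)).
  apply (is_RInt_fct_extend_pair (U := R_NormedModule) (V := R_NormedModule)).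
  - eapply is_RInt_ext; [|exact K1]. intros x _. apply O.
  - eapply is_RInt_ext; [|exact K2]. intros x _. apply Z.
Qed.

Lemma Phi2_exp (z : C) : in_disk z -> Phi2 s z = (z * Cexp (Jf z))%C.
Proof.
  intros hz. unfold Phi2. f_equal. f_equal.
  apply (is_RInt_unique (V := C_R_CompleteNormedModule)).
  eapply is_RInt_ext; [|apply is_RInt_ext_integrand, hz].
  rewrite Rmin_left, Rmax_right by lra. intros x hx. cbv zeta.
  destruct (Ceq_dec z (RtoC 0)) as [->|n]; [rewrite !Cmult_0_r; reflexivity|].
  assert (nx : RtoC x <> RtoC 0) by (intros E; apply RtoC_inj in E; lra).
  assert (hd : in_disk (RtoC x * z)%C) by (apply in_disk_scale; [exact hz|lra]).
  replace ((RtoC x * z) ^ 2)%C with (RtoC x * z * (RtoC x * z))%C by ring.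
  rewrite <- ext_series by exact hd.
  match goal with |- @eq _ ?x ?y => change (@eq C x y) end.
  field. split; assumption.
Qed.

Lemma Cmod_Cexp (z : C) : Cmod (Cexp z) = exp (Re z).
Proof.
  unfold Cexp. rewrite Cmod_polar; [reflexivity|]. left. apply exp_pos.
Qed.

Lemma Cexp_onto (z : C) : z <> RtoC 0 -> exists zeta, Cexp zeta = z.
Proof.
  intros n. assert (p : 0 < Cmod z) by (apply Cmod_gt_0; exact n).
  assert (E : Re z * Re z + Im z * Im z = Cmod z * Cmod z) by apply nsq_Cmod.
  assert (pol : exists t, Re z = Cmod z * cos t /\ Im z = Cmod z * sin t).
  { set (c := Re z / Cmod z).
    assert (hc : Re z = Cmod z * c) by (unfold c; field; lra).
    pose proof (abs_Re z) as B. apply Rabs_le_between in B.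
    assert (bc : -1 <= c <= 1).
    { split; apply Rmult_le_reg_l with (Cmod z); lra. }
    set (y := Im z / Cmod z).
    assert (hy : Im z = Cmod z * y) by (unfold y; field; lra).
    assert (U : 1 - Rsqr c = Rsqr y).
    { rewrite hc, hy in E. apply Rmult_eq_reg_l with (Cmod z * Cmod z); [unfold Rsqr; lra|nra]. }
    destruct (Rle_lt_dec 0 y) as [l|l].
    - exists (acos c). rewrite cos_acos, sin_acos, U, sqrt_Rsqr by assumption. split; assumption.
    - exists (- acos c). rewrite cos_neg, sin_neg, cos_acos, sin_acos, U by assumption.
      rewrite sqrt_Rsqr_abs, Rabs_left, Ropp_involutive by exact l. split; assumption. }
  destruct pol as [t [h1 h2]]. exists (ln (Cmod z), t).
  unfold Cexp. simpl. rewrite exp_ln by exact p. rewrite <- h1, <- h2.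
  destruct z; reflexivity.
Qed.

(** In the coordinate zeta = log z the logarithm of Phi is zeta + J(e^zeta), on a
    half-plane. Its derivative q_s(e^(2 zeta)) has positive real part, and on a
    convex set this forces injectivity. *)
Lemma Phi2_log_injective (x y : C) : Re x < 0 -> Re y < 0 ->
  (x + Jf (Cexp x) = y + Jf (Cexp y))%C -> x = y.
Proof.
  intros hx hy E. set (G := fun t => (t + Jf (Cexp t))%C).
  assert (hd : forall t, Re t < 0 -> in_disk (Cexp t)).
  { intros t ht. unfold in_disk. rewrite Cmod_Cexp, <- exp_0. apply exp_increasing, ht. }
  assert (DG : forall t, Re t < 0 -> cder G t (q_hpl s (Cexp t * Cexp t))).
  { intros t ht. rewrite <- ext_series by (apply hd, ht). eapply cder_eq.
    - apply cder_plus; [apply cder_id|]. apply (cder_comp Jf Cexp); [apply dJ, hd, ht|apply cder_Cexp].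
    - ring. }
  set (d := (y - x)%C).
  destruct (mvt_segment G (fun t => q_hpl s (Cexp t * Cexp t)) x d (Cconj d)) as [t [ht M]].
  { intros t ht. apply DG. unfold d. destruct x as [x1 x2], y as [y1 y2]. simpl in *. nra. }
  replace (x + d)%C with y in M by (unfold d; ring). unfold G in M. rewrite <- E in M.
  pose proof (Re_q_hpl_pos s (Cexp (x + RtoC t * d) * Cexp (x + RtoC t * d)) hs) as P.
  set (q := q_hpl s (Cexp (x + RtoC t * d) * Cexp (x + RtoC t * d))) in *.
  assert (M' : nsq d * Re q = 0).
  { clearbody d q. clear - M. destruct d, q. unfold nsq.
    replace (_ * _) with (Re (Cconj (r, r0) * ((r1, r2) * (r, r0)))%C) by (simpl; ring).
    rewrite <- M. generalize (x + Jf (Cexp x))%C. intros [p p']. simpl. ring. }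
  assert (d0 : d = RtoC 0).
  { apply nsq_eq_0. apply Rmult_integral in M'. destruct M' as [M'|M']; [exact M'|lra]. }
  replace y with (x + d)%C by (unfold d; ring). rewrite d0. ring.
Qed.

(** Equal values of Phi have logarithms that differ by a period of the
    exponential; moving one of the two points zeta by that period changes
    neither e^zeta nor the point of the disk. *)
Lemma Phi2_injective (z w : C) : in_disk z -> in_disk w ->
  (z * Cexp (Jf z) = w * Cexp (Jf w))%C -> z = w.
Proof.
  intros hz hw E.
  assert (zero : forall a b : C, (a * Cexp (Jf a) = b * Cexp (Jf b))%C -> a = RtoC 0 -> a = b).
  { intros p q Epq ->. rewrite Cmult_0_l in Epq.
    destruct (Ceq_dec q (RtoC 0)) as [->|n]; [reflexivity|].
    exfalso. symmetry in Epq. revert Epq. apply Cmult_neq_0; [exact n|apply Cexp_neq_0]. }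
  destruct (Ceq_dec z (RtoC 0)) as [z0|nz]; [apply zero; [exact E|exact z0]|].
  destruct (Ceq_dec w (RtoC 0)) as [w0|nw]; [symmetry; apply zero; [symmetry; exact E|exact w0]|].
  destruct (Cexp_onto z nz) as [x hx]. destruct (Cexp_onto w nw) as [y hy].
  assert (neg : forall t, in_disk (Cexp t) -> Re t < 0).
  { intros t ht. unfold in_disk in ht. rewrite Cmod_Cexp, <- exp_0 in ht. apply exp_lt_inv, ht. }
  (* a period of the exponential *)
  set (d := (x + Jf z - (y + Jf w))%C).
  assert (Ed : Cexp d = RtoC 1).
  { assert (K : (Cexp d * (w * Cexp (Jf w)) = 1 * (w * Cexp (Jf w)))%C).
    { rewrite <- hy at 1. rewrite <- !Cexp_plus. replace (d + (y + Jf w))%C with (x + Jf z)%C by (unfold d; ring).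
      rewrite Cexp_plus, hx, E. ring. }
    assert (nn : (w * Cexp (Jf w))%C <> RtoC 0) by (apply Cmult_neq_0; [exact nw|apply Cexp_neq_0]).
    transitivity (Cexp d * (w * Cexp (Jf w)) / (w * Cexp (Jf w)))%C; [field; split; [apply Cexp_neq_0|exact nw]|].
    rewrite K. field. split; [apply Cexp_neq_0|exact nw]. }
  assert (hy' : Cexp (y + d) = w) by (rewrite Cexp_plus, Ed, hy; ring).
  assert (xy : x = (y + d)%C).
  { apply Phi2_log_injective.
    - apply neg. rewrite hx; exact hz.
    - apply neg. rewrite hy'; exact hw.
    - rewrite hx, hy'. unfold d. ring. }
  rewrite <- hx, xy, hy'. reflexivity.
Qed.

Section Rotation.
Variable mu : C.
Hypothesis hmu : Cmod mu = 1.

Lemma conj_mu : (Cconj mu * mu)%C = RtoC 1.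
Proof. rewrite Cmult_comm, Cmult_conj_nsq, nsq_Cmod, hmu, Rmult_1_r. reflexivity. Qed.

Lemma in_disk_rot (z : C) : in_disk z -> in_disk (mu * z)%C.
Proof. unfold in_disk. rewrite Cmod_mult, hmu, Rmult_1_l. auto. Qed.

Lemma rotation_exp (z : C) : in_disk z -> rotation mu (Phi2 s) z = (z * Cexp (Jf (mu * z)))%C.
Proof.
  intros hz. unfold rotation. rewrite Phi2_exp by (apply in_disk_rot, hz).
  transitivity (Cconj mu * mu * (z * Cexp (Jf (mu * z))))%C; [ring|]. rewrite conj_mu. ring.
Qed.

Lemma rotation_derive (z : C) : in_disk z ->
  cder (rotation mu (Phi2 s)) z (Cexp (Jf (mu * z)) * q_hpl s (mu * mu * (z * z)))%C.
Proof.
  intros hz. pose proof (in_disk_rot z hz) as hm.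
  apply (cder_ext_disk (fun z => z * Cexp (Jf (mu * z)))%C); [exact hz| |].
  { intros w hw. symmetry. apply rotation_exp, hw. }
  replace (mu * mu * (z * z))%C with (mu * z * (mu * z))%C by ring.
  rewrite <- ext_series by exact hm.
  eapply cder_eq.
  - apply cder_mult; [apply cder_id|].
    apply (cder_comp Cexp (fun z => Jf (mu * z)%C)); [apply cder_Cexp|].
    apply (cder_comp Jf (fun z => mu * z)%C); [apply dJ, hm|].
    apply cder_mult; [apply cder_const|apply cder_id].
  - cbv beta. ring.
Qed.

Lemma rotation_quotient (z : C) : in_disk z ->
  starlike_quotient (rotation mu (Phi2 s)) z = q_hpl s (mu * mu * (z * z)).
Proof.
  intros hz. unfold starlike_quotient. destruct (Ceq_dec z (RtoC 0)) as [->|n].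
  - rewrite !Cmult_0_r, q_hpl_0. reflexivity.
  - rewrite (is_C_derive_unique _ _ _ (rotation_derive z hz)), rotation_exp by exact hz.
    field. split; [apply Cexp_neq_0|exact n].
Qed.

Lemma rotation_schwarz : schwarz_function (fun z => mu * mu * (z * z))%C.
Proof.
  split; [|split].
  - intros z _. eexists. apply (cder_mult (fun _ => mu * mu)%C); [apply cder_const|].
    apply cder_mult; apply cder_id.
  - intros z hz. unfold in_disk in *. rewrite !Cmod_mult, hmu. pose proof (Cmod_ge_0 z). nra.
  - ring.
Qed.

Definition rotation_coef (n : nat) : C :=
  match n with O => RtoC 0 | S m => (RtoC (exp_coef ext_coef m) * mu ^ m)%C end.

Lemma rotation_class_S : class_S (rotation mu (Phi2 s)).
Proof.
  split; [|split].
  - intros z hz. eexists. apply rotation_derive, hz.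
  - intros z w hz hw. rewrite !rotation_exp by assumption. intros E.
    pose proof (in_disk_rot z hz) as hmz. pose proof (in_disk_rot w hw) as hmw.
    assert (K : (mu * z)%C = (mu * w)%C).
    { apply Phi2_injective; auto. rewrite <- !Cmult_assoc, E. reflexivity. }
    transitivity (Cconj mu * mu * z)%C; [rewrite conj_mu; ring|].
    rewrite <- Cmult_assoc, K, Cmult_assoc, conj_mu. ring.
  - exists rotation_coef. split; [reflexivity|split; [unfold rotation_coef, exp_coef; simpl; ring|]].
    intros z hz. apply is_pseries_csum. rewrite rotation_exp by exact hz.
    pose proof (in_disk_rot z hz) as hm.
    unfold Jf. rewrite <- CPS_exp by (auto using ext_coef_bound).
    pose proof (CPS_sum _ _ (real_coef_disk _ (exp_coef_bound ext_coef ext_coef_bound)) hm) as S.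
    set (l := CPS (real_coef (exp_coef ext_coef)) (mu * z)%C) in *.
    replace (z * l)%C with (rotation_coef 0 * z ^ 0 + z * l)%C by (unfold rotation_coef; ring).
    apply (csum_incr (fun n => rotation_coef n * z ^ n)%C).
    eapply csum_ext; [|exact (csum_scal z _ _ S)]. intros n. cbv beta.
    unfold rotation_coef, real_coef. rewrite Cpow_mult_l. simpl Cpow. ring.
Qed.

Lemma rotation_ST_hpl : ST_hpl s (rotation mu (Phi2 s)).
Proof.
  split; [apply rotation_class_S|]. exists (fun z => mu * mu * (z * z))%C.
  split; [apply rotation_schwarz|apply rotation_quotient].
Qed.
End Rotation.
End Extremal.

Theorem theorem3p4 (s : R) (hs : (0 < s <= 1)%R) :
  (forall (f : C -> C) (a : nat -> C),
     ST_hpl s f -> normalized_expansion f a ->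
     (Cmod (a 2%nat * a 4%nat - a 3%nat ^ 2)%C <= s ^ 2 / 4)%R /\
     (forall mu : C, Cmod mu = 1%R ->
        (forall z : C, in_disk z -> f z = rotation mu (Phi2 s) z) ->
        Cmod (a 2%nat * a 4%nat - a 3%nat ^ 2)%C = (s ^ 2 / 4)%R)) /\
  (forall mu : C, Cmod mu = 1%R -> ST_hpl s (rotation mu (Phi2 s))).
Proof.
  split; [|intros mu hmu; apply rotation_ST_hpl; assumption].
  intros f a [Hf [w [Hw Hq]]] Ha. split.
  - apply (hankel_bound s f w a); auto; lra.
  - intros mu hmu E.
    apply (hankel_extremal s f (fun z => mu * mu * (z * z))%C a (proj1 hs) Hf Ha
      (rotation_schwarz mu hmu)) with (nu := (mu * mu)%C).
    + intros z hz. rewrite <- (rotation_quotient s hs mu hmu z hz).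
      unfold starlike_quotient. destruct (Ceq_dec z (RtoC 0)); [reflexivity|].
      pose proof (rotation_derive s hs mu hmu z hz) as D.
      rewrite (is_C_derive_unique _ _ _ D), <- E by exact hz.
      rewrite (is_C_derive_unique f z _ (cder_ext_disk _ f z _ hz (fun t ht => eq_sym (E t ht)) D)).
      reflexivity.
    + rewrite Cmod_mult, hmu. ring.
    + reflexivity.
Qed.
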